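(* Let $d=(u,\omega,x)$ be a design for the Gaussian linear model, and let a ridge datum with parameter $\tau^2>0$ and a known variance $\sigma_0^2>0$ be given. Choose a basis of $\omega$ which is orthonormal for the ridge datum and an enumeration of $u$, so that $x$ becomes an $n\times p$ matrix $X$ ($n=|u|$, $p=\dim\omega$, the $i$-th row being the coordinate vector of $x(i)$), and set $\lambda=\sigma_0^2/\tau^2$. Let $\mathbf P_d$ be the component at $d$ of the bridged model of the Gaussian linear model, and let $\pi^\tau_\omega$ be the ridge prior. (1) The prior predictive state is $m_d=\mathbf P_d\circ\pi^\tau_\omega=\mathcal N_n(0,\ \tau^2XX^\top+\sigma_0^2I_n)$. (2) The Bayesian inversion $\mathbf P_d^\dagger:\mathbb R^u\rightsquigarrow\omega^*\times\mathbb R_{>0}$ of $\mathbf P_d$ with respect to $\pi^\tau_\omega$ exists in $\mathsf{BorelStoch}$, and it is the Gaussian kernel $$\mathbf P_d^\dagger(y)=\mathcal N_p\bigl((X^\top X+\lambda I)^{-1}X^\top y,\ \sigma_0^2(X^\top X+\lambda I)^{-1}\bigr)$$ tensored with $\delta_{\sigma_0^2}$. (3) The mean of the posterior is the ridge estimator $\widehat\beta_\lambda(y)=(X^\top X+\lambda I)^{-1}X^\top y$, and the penalty is the ratio of the two variances, $\lambda=\sigma_0^2/\tau^2$.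
   Context: $\mathsf{BorelStoch}$ is the category of standard Borel spaces and Markov kernels $X\rightsquigarrow Y$, composed by $(k'\circ k)(x)(C)=\int k'(y)(C)\,k(x)(\mathrm dy)$; a state on $X$ is a probability measure on $X$ (a kernel from the one-point space). For a state $\pi$ on $X$ and a kernel $k:X\rightsquigarrow Y$, with $m=k\circ\pi$, a Bayesian inversion of $k$ with respect to $\pi$ (the posterior) is a kernel $k^\dagger:Y\rightsquigarrow X$ with $\int_Sk(x)(T)\,\pi(\mathrm dx)=\int_Tk^\dagger(y)(S)\,m(\mathrm dy)$ for all measurable $S\subseteq X$, $T\subseteq Y$; it is unique up to $m$-a.s. equality. Gaussian linear model: covariate spaces $\omega$ are finite dimensional real vector spaces, a design is a triple $(u,\omega,x)$ with $u$ a finite set of units and $x:u\to\omega$ a map; the parameter space is $\omega^*\times\mathbb R_{>0}$ with its Borel structure, the sample space is $\mathbb R^u$, and $\mathbf P_d:\omega^*\times\mathbb R_{>0}\rightsquigarrow\mathbb R^u$ is the kernel $(\beta,\sigma^2)\mapsto\bigotimes_{i\in u}\mathcal N(\beta(x(i)),\sigma^2)$. A ridge datum is a choice of an inner product $\langle\,,\rangle_\omega$ on each covariate space $\omega$ together with a real number $\tau^2>0$ not depending on $\omega$. With $I_\omega$ the form induced on $\omega^*$, the ridge prior is $\pi^\tau_\omega=\mathcal N(0,\tau^2I_\omega)\otimes\delta_{\sigma_0^2}$ on $\omega^*\times\mathbb R_{>0}$; in coordinates dual to an orthonormal basis of $\omega$, $\mathcal N(0,\tau^2I_\omega)$ is $\mathcal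 N_p(0,\tau^2I_p)$. The coordinates on $\omega^*$ in the statement are these dual coordinates. *)

(* Defs.v *)
From HB Require Import structures.
From mathcomp Require Import all_boot all_order all_algebra sesquilinear.
From mathcomp Require Import all_classical all_reals all_analysis.
From mathcomp Require Import measurable_realfun.

Set Implicit Arguments.
Unset Strict Implicit.
Unset Printing Implicit Defensive.

Import Order.TTheory GRing.Theory Num.Theory.

Local Open Scope classical_set_scope.
Local Open Scope ring_scope.

(* The sigma-algebra generated by a family of maps f i : aT -> T is
   <<s family_cylinders f >>. *)
Section family_sigma_algebra.
Context {d} {T : measurableType d} {I aT : Type} (f : I -> aT -> T).

Definition family_cylinders : set (set aT) :=
  [set f i @^-1` B | i in setT & B in measurable].

Lemma family_sigmaC (A : set aT) :
  <<s family_cylinders >> A -> <<s family_cylinders >> (~` A).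
Proof. by move=> sA; rewrite -setTD; exact: sigma_algebraCD. Qed.

End family_sigma_algebra.

(* Finite products {ffun I -> T} and matrix spaces carry the product
   sigma-algebra; for T = R it is the Borel sigma-algebra of R^I, resp. of
   R^(m x n). *)
Section ffun_measurable.
Context {d} {T : measurableType d} {I : finType}.

HB.instance Definition _ := isPointed.Build {ffun I -> T} [ffun=> point].

Let G := family_cylinders (fun i (y : {ffun I -> T}) => y i).

HB.instance Definition _ := @isMeasurable.Build (sigma_display G)
  {ffun I -> T} <<s G >> (@sigma_algebra0 _ setT G) (@family_sigmaC _ _ _ _ _)
  (@sigma_algebra_bigcup _ setT G).

Lemma measurable_ffun_eval (i : I) :
  measurable_fun setT (fun y : {ffun I -> T} => y i).
Proof.
move=> _ B mB; rewrite setTI; apply: sub_sigma_algebra.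
by exists i => //; exists B.
Qed.

Lemma measurable_ffunP d' (X : measurableType d') (g : X -> {ffun I -> T}) :
  (forall i, measurable_fun setT (fun x => g x i)) -> measurable_fun setT g.
Proof.
move=> mg; apply: (measurability (family_cylinders
  (fun i (y : {ffun I -> T}) => y i))) => //.
move=> _ [_ [i _ [B mB <-]] <-]; rewrite setTI.
by have := mg i measurableT B mB; rewrite setTI.
Qed.

End ffun_measurable.

Section matrix_measurable.
Context {d} {T : measurableType d} {m n : nat}.

Let G := family_cylinders
  (fun (ij : 'I_m * 'I_n) (M : 'M[T]_(m, n)) => M ij.1 ij.2).

HB.instance Definition _ := @isMeasurable.Build (sigma_display G)
  'M[T]_(m, n) <<s G >> (@sigma_algebra0 _ setT G) (@family_sigmaC _ _ _ _ _)
  (@sigma_algebra_bigcup _ setT G).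

Lemma measurable_mx_entry (i : 'I_m) (j : 'I_n) :
  measurable_fun [set: 'M[T]_(m, n)] (fun M => M i j).
Proof.
move=> _ B mB; rewrite setTI; apply: sub_sigma_algebra.
by exists (i, j) => //; exists B.
Qed.

Lemma measurable_mxP d' (X : measurableType d') (g : X -> 'M[T]_(m, n)) :
  (forall i j, measurable_fun setT (fun x => g x i j)) -> measurable_fun setT g.
Proof.
move=> mg; apply: (measurability (family_cylinders
  (fun (ij : 'I_m * 'I_n) (M : 'M[T]_(m, n)) => M ij.1 ij.2))) => //.
move=> _ [_ [[i j] _ [B mB <-]] <-]; rewrite setTI.
by have := mg i j measurableT B mB; rewrite setTI.
Qed.

End matrix_measurable.

(* The dual space of W; its Borel sigma-algebra is the one generated by the
   linear functionals beta |-> beta w, since W is finite dimensional. *)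
Definition dual (R : realType) (W : vectType R) := 'Hom(W, R^o).

Section dual_measurable.
Context {R : realType} {W : vectType R}.

HB.instance Definition _ := Choice.on (dual W).
HB.instance Definition _ := isPointed.Build (dual W) 0.

Let G := family_cylinders (fun (w : W) (beta : dual W) => beta w : R).

HB.instance Definition _ := @isMeasurable.Build (sigma_display G)
  (dual W) <<s G >> (@sigma_algebra0 _ setT G) (@family_sigmaC _ _ _ _ _)
  (@sigma_algebra_bigcup _ setT G).

Lemma measurable_dual_eval (w : W) :
  measurable_fun [set: dual W] ((fun beta => beta w) : dual W -> R).
Proof.
move=> _ B mB; rewrite setTI; apply: sub_sigma_algebra.
by exists w => //; exists B.
Qed.

Lemma measurable_dualP d' (X : measurableType d') (g : X -> dual W) :
  (forall w, measurable_fun [set: X] ((fun x => g x w) : X -> R)) ->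
  measurable_fun setT g.
Proof.
move=> mg; apply: (measurability (family_cylinders
  (fun (w : W) (beta : dual W) => beta w : R))) => //.
move=> _ [_ [w _ [B mB <-]] <-]; rewrite setTI.
by have := mg w measurableT B mB; rewrite setTI.
Qed.

End dual_measurable.

Definition posreal (R : realType) := {r : R | 0 < r}.

Section posreal_measurable.
Context {R : realType}.

HB.instance Definition _ := Choice.on (posreal R).
HB.instance Definition _ := isPointed.Build (posreal R) (exist _ 1 ltr01).

Let G := family_cylinders (fun (_ : unit) (s : posreal R) => sval s).

HB.instance Definition _ := @isMeasurable.Build (sigma_display G)
  (posreal R) <<s G >> (@sigma_algebra0 _ setT G) (@family_sigmaC _ _ _ _ _)
  (@sigma_algebra_bigcup _ setT G).

Lemma measurable_posreal_val :
  measurable_fun [set: posreal R] ((fun s => sval s) : posreal R -> R).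
Proof.
move=> _ B mB; rewrite setTI; apply: sub_sigma_algebra.
by exists tt => //; exists B.
Qed.

End posreal_measurable.

(* The product of a finite family of probability measures, as an iterated
   integral in the order enum I (fprod_rect gives its value on rectangles).
   The starting point is irrelevant, every coordinate being integrated out. *)
Section fprod.
Context {d} {T : measurableType d} {R : realType} {I : finType}.
Implicit Types (P : I -> probability T R) (y : {ffun I -> T}) (s : seq I).
Implicit Type f : {ffun I -> T} -> \bar R.
Local Open Scope ereal_scope.

Definition ffun_upd y (i : I) (t : T) : {ffun I -> T} :=
  [ffun j => if j == i then t else y j].

Definition marginal P (i : I) f := fun y => \int[P i]_t f (ffun_upd y i t).

Definition iterated_int P s f := foldr (marginal P) f s.

Definition fprod P (A : set {ffun I -> T}) : \bar R :=
  iterated_int P (enum I) (EFin \o \1_A) point.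

Lemma measurable_ffun_upd i :
  measurable_fun setT (fun z : {ffun I -> T} * T => ffun_upd z.1 i z.2).
Proof.
apply: measurable_ffunP => j.
rewrite (_ : (fun _ => _) =
    fun z : {ffun I -> T} * T => if j == i then z.2 else z.1 j); last first.
  by apply/funext => z; rewrite ffunE.
case: (j == i); first exact: measurable_snd.
by apply: (measurableT_comp (measurable_ffun_eval j)); exact: measurable_fst.
Qed.

Lemma marginal_ge0 P i f :
  (forall y, 0 <= f y) -> forall y, 0 <= marginal P i f y.
Proof. by move=> f0 y; apply: integral_ge0. Qed.

Lemma iterated_int_ge0 P s f :
  (forall y, 0 <= f y) -> forall y, 0 <= iterated_int P s f y.
Proof. by move=> f0; elim: s => //= i s ih; exact: marginal_ge0. Qed.

Section measurable_in_parameter.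
Context {d'} {X : measurableType d'} (K : X -> I -> probability T R).
Hypothesis mK : forall i (B : set T), measurable B ->
  measurable_fun [set: X] ((fun x => K x i B) : X -> \bar R).

Section one_coordinate.
Variable i : I.

Let l (z : X * {ffun I -> T}) : {measure set T -> \bar R} := K z.1 i.

Let ml U : measurable U -> measurable_fun setT (l ^~ U).
Proof. by move=> mU; exact: (measurableT_comp (mK i mU) measurable_fst). Qed.

HB.instance Definition _ := isKernel.Build _ _ _ _ R l ml.

Let l1 z : l z setT = 1. Proof. exact: probability_setT. Qed.

HB.instance Definition _ := Kernel_isProbability.Build _ _ _ _ R l l1.

Lemma measurable_marginal (f : X -> {ffun I -> T} -> \bar R) :
  (forall x y, 0 <= f x y) ->
  measurable_fun setT (fun z : X * {ffun I -> T} => f z.1 z.2) ->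
  measurable_fun setT
    (fun z : X * {ffun I -> T} => marginal (K z.1) i (f z.1) z.2).
Proof.
move=> f0 mf.
apply: (measurable_fun_integral_finite_kernel
  (fun w : (X * {ffun I -> T}) * T => f w.1.1 (ffun_upd w.1.2 i w.2)) l) => //.
apply: (measurableT_comp (f := fun z => f z.1 z.2) mf
  (g := fun w : (X * {ffun I -> T}) * T => (w.1.1, ffun_upd w.1.2 i w.2))).
apply: measurable_fun_pair; first exact: measurableT_comp.
apply: (measurableT_comp (measurable_ffun_upd i)
  (g := fun w : (X * {ffun I -> T}) * T => (w.1.2, w.2))).
by apply: measurable_fun_pair => //; exact: measurableT_comp.
Qed.

End one_coordinate.

Lemma measurable_iterated_int s f :
  (forall y, 0 <= f y) -> measurable_fun setT f ->
  measurable_fun setT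
    (fun z : X * {ffun I -> T} => iterated_int (K z.1) s f z.2).
Proof.
move=> f0 mf; elim: s => /= [|i s ih].
  by apply: (measurableT_comp mf); exact: measurable_snd.
apply: (@measurable_marginal i (fun x => iterated_int (K x) s f)) => //.
by move=> x; exact: iterated_int_ge0.
Qed.

Lemma measurable_fprod A :
  measurable A -> measurable_fun [set: X] (fun x => fprod (K x) A).
Proof.
move=> mA; pose f : {ffun I -> T} -> \bar R := EFin \o \1_A.
have mf : measurable_fun setT f by exact/measurable_EFinP/measurable_indic.
have f0 y : 0 <= f y by rewrite lee_fin.
by have := measurable_iterated_int (enum I) f0 mf => /(measurable_fun_pair1 point).
Qed.

End measurable_in_parameter.

Lemma measurable_iterated_int1 P s f :
  (forall y, 0 <= f y) -> measurable_fun setT f ->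
  measurable_fun setT (iterated_int P s f).
Proof.
move=> f0 mf.
have mP i (B : set T) : measurable B ->
  measurable_fun [set: unit] ((fun _ => P i B) : unit -> \bar R) by [].
by have /(measurable_fun_pair2 tt) := measurable_iterated_int mP s f0 mf.
Qed.

Lemma iterated_int_cst P s c : iterated_int P s (cst c) = cst c.
Proof.
elim: s => //= i s ->; apply/funext => y; rewrite /marginal /= integral_cst//.
by rewrite [X in _ * X](probability_setT (P i)) mule1.
Qed.

Lemma iterated_int_nneseries P s (f : ({ffun I -> T} -> \bar R)^nat) :
  (forall n y, 0 <= f n y) -> (forall n, measurable_fun setT (f n)) ->
  iterated_int P s (fun y => \sum_(n <oo) f n y) =
  fun y => \sum_(n <oo) iterated_int P s (f n) y.
Proof.
move=> f0 mf; elim: s => //= i s ->; apply/funext => y.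
rewrite /marginal integral_nneseries// => [n|n t _]; last first.
  exact: iterated_int_ge0.
apply: (measurableT_comp (measurable_iterated_int1 P s (f0 n) (mf n))).
apply: (measurableT_comp (measurable_ffun_upd i) (g := fun t => (y, t))).
exact: pair1_measurable.
Qed.

Section fprod_is_probability.
Variable P : I -> probability T R.

Let fprod0 : fprod P set0 = 0.
Proof.
rewrite /fprod (_ : EFin \o _ = cst 0) ?iterated_int_cst//.
by apply/funext => y /=; rewrite indic0.
Qed.

Let fprod_ge0 A : 0 <= fprod P A.
Proof. by apply: iterated_int_ge0 => y; rewrite lee_fin. Qed.

Let fprod_sigma_additive : semi_sigma_additive (fprod P).
Proof.
move=> F mF tF mUF.
rewrite [X in _ --> X](_ : _ = \sum_(n <oo) fprod P (F n)).
  by apply: is_cvg_ereal_nneg_natsum => n _; exact: fprod_ge0.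
rewrite /fprod.
rewrite (_ : EFin \o _ = fun y => \sum_(n <oo) (\1_(F n) y)%:E); last first.
  by apply/funext => y /=; rewrite indic_bigcup.
by rewrite iterated_int_nneseries// => n; exact/measurable_EFinP/measurable_indic.
Qed.

HB.instance Definition _ := isMeasure.Build _ _ _ (fprod P)
  fprod0 fprod_ge0 fprod_sigma_additive.

Let fprod_setT : fprod P setT = 1.
Proof.
rewrite /fprod (_ : EFin \o _ = cst 1) ?iterated_int_cst//.
by apply/funext => y /=; rewrite indicT.
Qed.

HB.instance Definition _ :=
  Measure_isProbability.Build _ _ _ (fprod P) fprod_setT.

End fprod_is_probability.

Lemma fprod_rect P (A : I -> set T) : (forall i, measurable (A i)) ->
  fprod P [set y | forall i, A i (y i)] = \prod_i P i (A i).
Proof.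
move=> mA; pose g (s : seq I) (y : {ffun I -> T}) : R :=
  (\prod_(i | i \notin s) \1_(A i) (y i))%R.
have E s : uniq s -> iterated_int P s (EFin \o g [::]) =
    fun y => (\prod_(i <- s) P i (A i)) * (g s y)%:E.
  elim: s => [_|i s ih /= /andP[iNs us]].
    by apply/funext => y; rewrite /= big_nil mul1e.
  rewrite (ih us); apply/funext => y; rewrite /marginal.
  have gE t : g s (ffun_upd y i t) = (\1_(A i) t * g (i :: s) y)%R.
    rewrite /g (bigD1 i)//= ffunE eqxx; congr (_ * _)%R.
    apply: eq_big => [j|j /andP[_ /negPf ji]]; last by rewrite ffunE ji.
    by rewrite inE negb_or andbC.
  have fP j : P j (A j) \is a fin_num by exact: fin_num_measure.
  under eq_integral do rewrite gE EFinM muleCA.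
  have g0 : (0 <= g (i :: s) y)%R.
    by apply: prodr_ge0 => j _; rewrite indicE.
  rewrite ge0_integralZr//.
  - by rewrite integral_indic// setIT big_cons muleA.
  - exact/measurable_EFinP/measurable_indic.
  - by rewrite mule_ge0// ?lee_fin// prode_ge0.
rewrite /fprod (_ : EFin \o _ = EFin \o g [::]).
  rewrite E ?enum_uniq// big_enum /g [X in _ * X%:E]big1 ?mule1// => i.
  by rewrite mem_enum.
apply/funext => y /=; congr EFin; rewrite /g.
have [yA|yA] := pselect (forall i, A i (y i)).
  by rewrite indicE mem_set// big1// => i _; rewrite indicE mem_set.
rewrite indicE memNset//.
have /existsNP[i yi] := yA.
by rewrite (bigD1 i)//= indicE memNset// mul0r.
Qed.

End fprod.

(* N(m, v) on R, parameterized by the variance v (normal_prob takes the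
   standard deviation, and is typed on measurableTypeR R). *)
Section normal_law.
Context {R : realType} (m v : R).

Definition normal_law (V : set R) : \bar R := normal_prob m (Num.sqrt v) V.

Let N := normal_prob m (Num.sqrt v).

Let normal_law0 : normal_law set0 = 0%E. Proof. exact: (measure0 N). Qed.

Let normal_law_ge0 V : (0 <= normal_law V)%E. Proof. exact: (measure_ge0 N). Qed.

Let normal_law_sigma_additive : semi_sigma_additive normal_law.
Proof. exact: (@measure_semi_sigma_additive _ _ _ N). Qed.

HB.instance Definition _ := isMeasure.Build _ _ _ normal_law
  normal_law0 normal_law_ge0 normal_law_sigma_additive.

Let normal_law_setT : normal_law setT = 1%E.
Proof. exact: (probability_setT N). Qed.

HB.instance Definition _ :=
  Measure_isProbability.Build _ _ _ normal_law normal_law_setT.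

End normal_law.

Section normal_measurable_in_parameters.
Context {R : realType} {d'} {X : measurableType d'} (m s : X -> R).
Hypotheses (mm : measurable_fun setT m) (ms : measurable_fun setT s).
Hypothesis s0 : forall x, 0 < s x.

Lemma measurable_normal_prob_param (B : set R) : measurable B ->
  measurable_fun [set: X] ((fun x => normal_prob (m x) (s x) B) : X -> \bar R).
Proof.
move=> mB.
pose f (z : X * R) : \bar R := (normal_pdf (m z.1) (s z.1) z.2 * \1_B z.2)%:E.
rewrite (_ : (fun x => _) = fubini_F (@lebesgue_measure R) f); last first.
  apply/funext => x; rewrite /normal_prob integral_mkcond.
  apply: eq_integral => t _; rewrite /f patchE indicE.
  by case: ifPn; rewrite ?mulr1 ?mulr0.
apply: measurable_fun_fubini_tonelli_F; last first.
  by move=> z; rewrite lee_fin mulr_ge0// normal_pdf_ge0.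
apply/measurable_EFinP; apply: measurable_funM; last exact: measurableT_comp.
have ms1 : measurable_fun setT (fun z : X * R => s z.1).
  exact: measurableT_comp.
have mm1 : measurable_fun setT (fun z : X * R => m z.1).
  exact: measurableT_comp.
have mV (g : X * R -> R) : (forall z, 0 < g z) -> measurable_fun setT g ->
    measurable_fun setT (fun z => (g z)^-1).
  move=> g0 mg; rewrite (_ : (fun z => _) = fun z => expR (- ln (g z))).
    apply: measurableT_comp => //; apply: measurableT_comp => //.
    exact: (measurableT_comp (@measurable_ln R)).
  by apply/funext => z; rewrite expRN lnK// posrE.
rewrite (_ : (fun _ => _) = fun z : X * R =>
    normal_peak (s z.1) * normal_fun (m z.1) (s z.1) z.2); last first.
  by apply/funext => z; rewrite normal_pdfE// gt_eqF.
apply: measurable_funM.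
  apply: mV => [z|].
    by rewrite sqrtr_gt0 pmulrn_lgt0// mulr_gt0 ?pi_gt0// exprn_gt0.
  apply: (measurableT_comp (continuous_measurable_fun (@sqrt_continuous R))).
  under eq_fun do rewrite mulr2n.
  apply: measurable_funD; apply: measurable_funM => //; exact: measurable_funX.
apply: measurableT_comp => //.
apply: measurable_funM.
  apply: measurableT_comp => //; apply: measurable_funX.
  by apply: measurable_funB => //; exact: measurable_snd.
apply: mV => [z|]; first by rewrite pmulrn_lgt0// exprn_gt0.
under eq_fun do rewrite mulr2n.
by apply: measurable_funD; exact: measurable_funX.
Qed.

End normal_measurable_in_parameters.

(* N_n(mu, Sigma) is the law of mu + A z, where z has independent N(0, 1)
   coordinates and A is any matrix with A A^T = Sigma; the law depends only on
   A A^T. Such an A exists iff Sigma is symmetric positive semidefinite; for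
   other Sigma the definition is meaningless (mxsqrt returns 0). *)
Section gaussian.
Context {R : realType} {n : nat}.

Definition mxsqrt (Sigma : 'M[R]_n) : 'M[R]_n :=
  xget 0 [set A : 'M[R]_n | A *m A^T = Sigma].

Definition std_normal : probability {ffun 'I_n -> R} R :=
  fprod (fun=> normal_law 0 1 : probability R R).

Definition affine_map (mu : 'cV[R]_n) (A : 'M[R]_n) (z : {ffun 'I_n -> R}) :
  'cV[R]_n := mu + A *m \col_i z i.

Lemma measurable_affine_map mu A : measurable_fun setT (affine_map mu A).
Proof.
apply: measurable_mxP => i j.
rewrite (_ : (fun z => _) =
    fun z : {ffun 'I_n -> R} => mu i j + \sum_k A i k * z k); last first.
  apply/funext => z; rewrite !mxE; congr (_ + _).
  by apply: eq_bigr => k _; rewrite mxE.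
apply: measurable_funD; first exact: measurable_cst.
apply: measurable_sum => k; apply: measurable_funM; first exact: measurable_cst.
exact: measurable_ffun_eval.
Qed.

HB.instance Definition _ mu A := isMeasurableFun.Build _ _ _ _
  (affine_map mu A) (measurable_affine_map mu A).

Definition gaussian (mu : 'cV[R]_n) (Sigma : 'M[R]_n) : probability 'cV[R]_n R :=
  distribution std_normal (affine_map mu (mxsqrt Sigma)).

End gaussian.

Section bayesian_inversion.
Context {d1 d2} {X : measurableType d1} {Y : measurableType d2} {R : realType}.

(* The state k o pi, the state pi being regarded as a kernel from unit. *)
Definition push_state (pi : probability X R) (k : R.-pker X ~> Y) :
    {measure set Y -> \bar R} :=
  mkcomp_noparam
    (kprobability (@measurable_cst _ _ unit _ setT (pi : pprobability X R))) k tt.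

Lemma push_stateE pi k C : push_state pi k C = (\int[pi]_x k x C)%E.
Proof. by []. Qed.

Definition bayesian_inversion (pi : probability X R)
    (k : R.-pker X ~> Y) (k' : R.-pker Y ~> X) :=
  forall (S : set X) (C : set Y), measurable S -> measurable C ->
    (\int[pi]_(x in S) k x C = \int[push_state pi k]_(y in C) k' y S)%E.

End bayesian_inversion.

Record design (R : realType) := Design {
  units : finType;
  covariate_space : vectType R;
  covariate : units -> covariate_space }.

Definition parameter_space (R : realType) (W : vectType R) :=
  (dual W * posreal R)%type.

HB.instance Definition _ (R : realType) (W : vectType R) :=
  Measurable.on (parameter_space W).

Section linear_model.
Context {R : realType} (d : design R).

Definition linear_model_factor (theta : parameter_space (covariate_space d))
    (i : units d) : probability R R :=
  normal_law (theta.1 (covariate i)) (sval theta.2).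

Definition linear_model (theta : parameter_space (covariate_space d)) :
    {measure set {ffun units d -> R} -> \bar R} :=
  fprod (linear_model_factor theta).

Let measurable_linear_model (A : set {ffun units d -> R}) : measurable A ->
  measurable_fun setT (linear_model ^~ A).
Proof.
move=> mA; apply: (measurable_fprod (K := linear_model_factor)) => // i B mB.
pose Theta := parameter_space (covariate_space d).
apply: (measurable_normal_prob_param
  (m := fun theta : Theta => theta.1 (covariate i))
  (s := fun theta : Theta => Num.sqrt (sval theta.2))) => //.
- exact: (measurableT_comp (measurable_dual_eval _) measurable_fst).
- apply: (measurableT_comp (continuous_measurable_fun (@sqrt_continuous R))).
  exact: (measurableT_comp (@measurable_posreal_val R) measurable_snd).
- by move=> [b [s s0]]; rewrite sqrtr_gt0.
Qed.

HB.instance Definition _ :=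
  isKernel.Build _ _ _ _ R linear_model measurable_linear_model.

Let linear_model_setT theta : linear_model theta setT = 1%E.
Proof. exact: probability_setT. Qed.

HB.instance Definition _ :=
  Kernel_isProbability.Build _ _ _ _ R linear_model linear_model_setT.

End linear_model.

Arguments linear_model {R} d theta.

Record ridge_datum (R : realType) := RidgeDatum {
  ridge_ip : forall W : vectType R, {dot W for idfun};
  ridge_tau2 : R;
  ridge_tau2_gt0 : 0 < ridge_tau2 }.

(* Coordinates on dual W in the basis dual to b: the j-th coordinate of beta
   is beta (b j). *)
Section dual_coordinates.
Context {R : realType} {W : vectType R} {p : nat} (b : p.-tuple W).

Definition dual_coord (beta : dual W) : 'cV[R]_p := \col_j beta (tnth b j).

Definition dual_of_coord (a : 'cV[R]_p) : dual W :=
  \sum_(j < p) a j 0 *: linfun (coord b j : W -> R^o).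

Lemma dual_coordK : basis_of fullv b -> cancel dual_coord dual_of_coord.
Proof.
move=> bb beta; apply/lfunP => w.
rewrite [in RHS](coord_basis bb (memvf w)) linear_sum sum_lfunE.
apply: eq_bigr => j _; rewrite scale_lfunE lfunE/= mxE linearZ/=.
by rewrite (tnth_nth 0) /GRing.scale/= mulrC.
Qed.

Lemma dual_of_coordK : basis_of fullv b -> cancel dual_of_coord dual_coord.
Proof.
move=> bb a; apply/colP => i; rewrite mxE sum_lfunE (bigD1 i)//=.
rewrite scale_lfunE lfunE/= (tnth_nth 0) coord_free ?(basis_free bb)//.
rewrite eqxx /GRing.scale/= mulr1 big1 ?addr0// => j ji.
rewrite scale_lfunE lfunE/= coord_free ?(basis_free bb)//.
by rewrite eq_sym (negPf ji) scaler0.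
Qed.

Lemma measurable_dual_of_coord : measurable_fun setT dual_of_coord.
Proof.
apply: measurable_dualP => w.
rewrite (_ : (fun a => _) =
    fun a : 'cV[R]_p => \sum_(j < p) a j 0 * coord b j w); last first.
  apply/funext => a; rewrite sum_lfunE.
  by apply: eq_bigr => j _; rewrite scale_lfunE lfunE.
apply: measurable_sum => j; apply: measurable_funM; last exact: measurable_cst.
exact: measurable_mx_entry.
Qed.

HB.instance Definition _ := isMeasurableFun.Build _ _ _ _ dual_of_coord
  measurable_dual_of_coord.

End dual_coordinates.

Section ridge_prior.
Context {R : realType} (rd : ridge_datum R) (W : vectType R).

Definition gram p (b : p.-tuple W) : 'M[R]_p :=
  \matrix_(i, j) ridge_ip rd W (tnth b i) (tnth b j).

(* N(0, tau^2 I_W): the centred Gaussian measure on dual W for which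
   beta w and beta w' have covariance tau^2 <w, w'>. It is written in the
   library's reference basis of W, where the coordinates of beta have covariance
   tau^2 times the Gram matrix; that matrix is the identity in an orthonormal
   basis. *)
Definition ridge_gaussian : probability (dual W) R :=
  distribution (gaussian 0 (ridge_tau2 rd *: gram (vbasis {:W})))
    (dual_of_coord (vbasis {:W})).

Definition ridge_prior (s0 : posreal R) : probability (parameter_space W) R :=
  (ridge_gaussian \x \d_s0)%E.

End ridge_prior.

Section regression_coordinates.
Context {R : realType} (d : design R) {n p : nat}.
Context (e : p.-tuple (covariate_space d)) (enu : 'I_n -> units d).

Definition design_matrix : 'M[R]_(n, p) :=
  \matrix_(i, j) coord e j (covariate (enu i)).

Definition sample_coord (y : {ffun units d -> R}) : 'cV[R]_n :=
  \col_i y (enu i).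

Definition parameter_coord (theta : parameter_space (covariate_space d)) :
  'cV[R]_p * posreal R := (dual_coord e theta.1, theta.2).

End regression_coordinates.

Definition ridge_estimator (R : realType) (n p : nat) (X : 'M[R]_(n, p))
    (lam : R) (y : 'cV[R]_n) : 'cV[R]_p :=
  invmx (X^T *m X + lam%:M) *m X^T *m y.

(* Main.v *)
Require Import Defs.
From HB Require Import structures.
From mathcomp Require Import all_boot all_order all_algebra sesquilinear.
From mathcomp Require Import all_classical all_reals all_analysis.
From mathcomp Require Import measurable_realfun.
From mathcomp Require Import ring lra.

(** A centred Gaussian law mu of covariance Sigma on R^n satisfies the
Cameron-Martin formula: translating mu by Sigma t multiplies it by the density
exp (t . x - t . Sigma t / 2). The proof takes this formula, as the predicate
[cameron_martin mu Sigma], for the working description of Gaussian laws, because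
of three properties.
- It is inherited by images and products, with the expected covariances:
  M Sigma M^T for the image under a matrix M ([cameron_martin_linear]), a block
  diagonal matrix for a product ([cameron_martin_prod]).
- Independent N(0, v) coordinates satisfy it with covariance v I
  ([cameron_martin_noise_col]). The law of the noise is unchanged when one
  coordinate is redrawn ([ge0_integral_fprod_resample]), so coordinates can be
  translated one at a time, and on the line the formula is the completion of a
  square in the normal density.
- When Sigma is invertible it determines mu ([cameron_martin_unique]). If nu
  satisfies it too, the double integral of F (x + y) y against mu(dx) nu(dy)
  can be evaluated in both orders with the formula; for
  F x y = 1_A x exp (q y y / 2 - q x y), where q is the form of Sigma^-1, one
  order gives mu A and the other nu A.

Hence two laws built linearly from Gaussian ones are equal as soon as their
covariances are equal and invertible. In orthonormal coordinates the prior is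
a ~ N(0, tau^2 I) ([cameron_martin_ridge_gaussian]) and the observation is
y = X a + noise ([linear_model_coord]). The pair (a, y) has covariance
  [[tau^2 I, tau^2 X^T], [tau^2 X, Sy]]   with Sy = tau^2 X X^T + s^2 I.
Put K = X^T X + lambda I with lambda = s^2 / tau^2. If y ~ N(0, Sy) and
z ~ N(0, s^2 K^-1) are independent, the pair (K^-1 X^T y + z, y) has the same
covariance ([ridge_gain_cov], [ridge_cov_decomp]), hence the same law. This
equality is Bayes' formula with the announced posterior ([gaussian_bayes]); the
predictive law is its case where the parameter is unconstrained.

Uniqueness of the inversion holds because the parameter space has a countable
family of sets on which a finite measure is determined, namely the rational
orthants in the dual coordinates and the variance ([orthant_measure_unique]):
two inversions agree almost surely on each of them, hence almost surely on all
of them ([kernel_ae_unique]). Finally a centred Gaussian law is symmetric, by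
[cameron_martin_unique] again, so the mean of the posterior is its centre. *)

Set Implicit Arguments.
Unset Strict Implicit.
Unset Printing Implicit Defensive.

Import Order.TTheory GRing.Theory Num.Theory.

Local Open Scope classical_set_scope.
Local Open Scope ring_scope.

(* The product measure, not the product of finite types of the same name. *)
Local Notation fprod := Defs.fprod.

(** * Normal laws on the line *)

Section normal_law_shift.
Context {R : realType}.
Implicit Types (m s t v : R).
Local Notation leb := (@lebesgue_measure R).

Lemma lebesgue_measure_shift t (A : set R) : measurable A ->
  leb ((fun x => x + t) @^-1` A) = leb A.
Proof.
move=> mA.
pose shift : measurableTypeR R -> measurableTypeR R := fun x => x + t.
have mshift : measurable_fun setT shift by exact: measurable_funD.
rewrite -[LHS]/(pushforward leb shift A).
apply/esym/lebesgue_measure_unique => // _ [[a b]] _ <-.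
rewrite /= /pushforward (_ : _ @^-1` _ = `]a - t, b - t]%classic); last first.
  by apply/seteqP; split => x /=; rewrite !in_itv/= ltrBlDr lerBrDr.
rewrite !lebesgue_measure_itv/= !lte_fin ltrD2r; case: ifP => // _.
by rewrite -!EFinB; congr EFin; lra.
Qed.

Lemma ge0_integral_lebesgue_shift t (f : R -> \bar R) :
  measurable_fun setT f -> (forall x, 0 <= f x)%E ->
  (\int[leb]_x f ((x : R) + t)%R = \int[leb]_x f x)%E.
Proof.
move=> mf f0.
pose shift : measurableTypeR R -> measurableTypeR R := fun x => x + t.
have mshift : measurable_fun setT shift by exact: measurable_funD.
rewrite [RHS](eq_measure_integral (pushforward leb shift)); last first.
  by move=> A mA _; rewrite /= /pushforward lebesgue_measure_shift.
by rewrite ge0_integral_pushforward//.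
Qed.

(** The density and the Radon-Nikodym derivative of the normal law have the same
integral on every measurable set, so they agree almost everywhere. *)
Lemma ge0_integral_normal_law m v (f : R -> \bar R) :
  measurable_fun setT f -> (forall x, 0 <= f x)%E ->
  (\int[normal_law m v]_x f x =
   \int[leb]_x (f x * (normal_pdf m (Num.sqrt v) x)%:E))%E.
Proof.
move=> mf f0; pose s := Num.sqrt v.
have mf' : measurable_fun setT (f : measurableTypeR R -> \bar R) by [].
transitivity (\int[normal_prob m s]_x f x)%E.
  (* [normal_prob] is a measure on another copy of the line, with the same
     measurable sets; the identity carries one integral to the other. *)
  pose i : measurableTypeR R -> R := id.
  have mi : measurable_fun setT i by move=> _ B mB; rewrite setTI.
  rewrite (eq_measure_integral (pushforward (normal_prob m s) i)) => [|//].
  by rewrite ge0_integral_pushforward.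
have dom := normal_prob_dominates m s.
rewrite -(Radon_Nikodym_SigmaFinite.change_of_variables dom)//.
have mpdf : measurable_fun setT (fun x => (normal_pdf m s x)%:E).
  by apply/measurable_EFinP; exact: measurable_normal_pdf.
apply: ge0_ae_eq_integral => //.
- apply: emeasurable_funM => //.
  exact: measurable_int (Radon_Nikodym_SigmaFinite.f_integrable dom).
- exact: emeasurable_funM.
- by move=> x _; rewrite mule_ge0 ?Radon_Nikodym_SigmaFinite.f_ge0.
- by move=> x _; rewrite mule_ge0 ?lee_fin ?normal_pdf_ge0.
- apply: ae_eqe_mul2l => /=; apply: integral_ae_eq => //.
  + exact: Radon_Nikodym_SigmaFinite.f_integrable.
  + by move=> E _ mE; rewrite -Radon_Nikodym_SigmaFinite.f_integral.
Qed.

Lemma normal_pdf_expR m s x : s != 0 ->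
  normal_pdf m s x = normal_peak s * expR (- (x - m) ^+ 2 / (s ^+ 2 *+ 2)).
Proof. by move=> s0; rewrite normal_pdfE. Qed.

Lemma normal_pdf_shift m s t x :
  s != 0 -> normal_pdf m s (x - t) = normal_pdf (m + t) s x.
Proof.
move=> s0; rewrite (normal_pdf_expR _ _ s0) (normal_pdf_expR _ x s0).
by rewrite opprD addrA [x - t - m]addrAC.
Qed.

(** Together with [fprod_normal_shift], this makes the noise of the linear model
independent of the parameter. *)
Lemma normal_law_shift m v (B : set R) : 0 < v -> measurable B ->
  normal_law m v B = normal_law 0 v [set x | B (m + x)].
Proof.
move=> v0 mB.
have s0 : Num.sqrt v != 0 by rewrite gt_eqF// sqrtr_gt0.
rewrite /normal_law /normal_prob integral_mkcond [RHS]integral_mkcond.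
rewrite -(ge0_integral_lebesgue_shift m).
- apply: eq_integral => x _; rewrite !patchE /=.
  rewrite -{1}[m in normal_pdf m]add0r -normal_pdf_shift// addrK.
  have -> : (x + m \in B) = (x \in [set x | B (m + x)]).
    by apply/idP/idP; rewrite !in_setE/= addrC.
  by [].
- apply: (iffLR (measurable_restrictT _ mB)); apply: measurable_funTS.
  have mpdf : measurable_fun setT (fun x : R => (normal_pdf m (Num.sqrt v) x)%:E).
    by apply/measurable_EFinP; exact: measurable_normal_pdf.
  exact: mpdf.
- by move=> x; rewrite patchE; case: ifP; rewrite ?lee_fin ?normal_pdf_ge0.
Qed.

(** Completing the square in the exponent. *)
Lemma normal_pdf_tilt v t x : 0 < v ->
  normal_pdf 0 (Num.sqrt v) (x - v * t) =
  normal_pdf 0 (Num.sqrt v) x * expR (t * x - v * t ^+ 2 / 2).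
Proof.
move=> v0; have s0 : Num.sqrt v != 0 by rewrite gt_eqF// sqrtr_gt0.
rewrite (normal_pdf_expR _ x s0) (normal_pdf_expR _ _ s0) -[RHS]mulrA -expRD.
rewrite sqr_sqrtr ?ltW//.
by congr (_ * expR _); field; rewrite gt_eqF.
Qed.

Lemma cameron_martin_normal_law v t (f : R -> \bar R) : 0 < v ->
  measurable_fun setT f -> (forall x, 0 <= f x)%E ->
  (\int[normal_law 0 v]_x f (x + v * t)%R =
   \int[normal_law 0 v]_x (f x * (expR (t * x - v * t ^+ 2 / 2))%:E))%E.
Proof.
move=> v0 mf f0.
have mpdf : measurable_fun setT (fun x => (normal_pdf 0 (Num.sqrt v) x)%:E).
  by apply/measurable_EFinP; exact: measurable_normal_pdf.
have mexp : measurable_fun setT (fun x => (expR (t * x - v * t ^+ 2 / 2))%:E).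
  apply/measurable_EFinP/measurableT_comp => //.
  by apply: measurable_funB => //; exact: measurable_funM.
have mfs : measurable_fun setT (fun x : R => f (x + v * t)).
  by apply: (measurableT_comp mf); exact: measurable_funD.
rewrite !ge0_integral_normal_law//; last 2 first.
- exact: emeasurable_funM.
- by move=> x; rewrite mule_ge0 ?lee_fin ?expR_ge0.
rewrite -[LHS](ge0_integral_lebesgue_shift (- (v * t))); last 2 first.
- exact: emeasurable_funM.
- by move=> x; rewrite mule_ge0 ?lee_fin ?normal_pdf_ge0.
apply: eq_integral => x _.
by rewrite subrK normal_pdf_tilt// -muleA -EFinM [in LHS]mulrC.
Qed.

End normal_law_shift.

(** * Images of laws and measurability of matrix operations *)

Section image_law.
Context {d1 d2} {T : measurableType d1} {T' : measurableType d2} {R : realType}.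

(** [distribution] with the measurability of the map as an argument, so that it
applies to maps that carry no canonical structure. *)
Definition image_law (P : probability T R) (f : T -> T')
    (mf : measurable_fun setT f) : probability T' R :=
  let mixin := isMeasurableFun.Build _ _ _ _ f mf in
  let F : {mfun T >-> T'} := HB.pack f mixin in
  distribution P F.

Lemma ge0_integral_image_law (P : probability T R) (f : T -> T')
    (mf : measurable_fun setT f) (g : T' -> \bar R) :
  measurable_fun setT g -> (forall y, 0 <= g y)%E ->
  (\int[image_law P mf]_y g y = \int[P]_x g (f x))%E.
Proof. by move=> mg g0; exact: ge0_integral_distribution. Qed.

End image_law.

Section measurable_matrix_operations.
Context {R : realType} {d} {X : measurableType d}.

Lemma measurable_mx_coef m n (g : X -> 'M[R]_(m, n)) i j :
  measurable_fun setT g -> measurable_fun setT (fun x => g x i j).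
Proof. by move=> mg; exact: (measurableT_comp (measurable_mx_entry i j) mg). Qed.

Lemma measurable_addmx m n (g h : X -> 'M[R]_(m, n)) :
  measurable_fun setT g -> measurable_fun setT h ->
  measurable_fun setT (fun x => g x + h x).
Proof.
move=> mg mh; apply: measurable_mxP => i j; under eq_fun do rewrite mxE.
by apply: measurable_funD; exact: measurable_mx_coef.
Qed.

Lemma measurable_trmx m n (g : X -> 'M[R]_(m, n)) :
  measurable_fun setT g -> measurable_fun setT (fun x => (g x)^T).
Proof.
move=> mg; apply: measurable_mxP => i j; under eq_fun do rewrite mxE.
exact: measurable_mx_coef.
Qed.

Lemma measurable_mulmx m n p (g : X -> 'M[R]_(m, n)) (h : X -> 'M[R]_(n, p)) :
  measurable_fun setT g -> measurable_fun setT h ->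
  measurable_fun setT (fun x => g x *m h x).
Proof.
move=> mg mh; apply: measurable_mxP => i j; under eq_fun do rewrite mxE.
by apply: measurable_sum => k; apply: measurable_funM; exact: measurable_mx_coef.
Qed.

Lemma measurable_col_mx m n p (g : X -> 'M[R]_(m, p)) (h : X -> 'M[R]_(n, p)) :
  measurable_fun setT g -> measurable_fun setT h ->
  measurable_fun setT (fun x => col_mx (g x) (h x)).
Proof.
move=> mg mh; apply: measurable_mxP => i j; under eq_fun do rewrite mxE.
by case: (fintype.split i) => k; exact: measurable_mx_coef.
Qed.

End measurable_matrix_operations.

(** * The Cameron-Martin formula and uniqueness *)

Section dotmx.
Context {R : realType}.

Definition dotmx n (x y : 'cV[R]_n) : R := (x^T *m y) 0 0.

Lemma dotmxC n (x y : 'cV[R]_n) : dotmx x y = dotmx y x.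
Proof. by rewrite /dotmx -[in RHS](trmxK x) -trmx_mul [RHS]mxE. Qed.

Lemma dotmxDr n (x y z : 'cV[R]_n) : dotmx x (y + z) = dotmx x y + dotmx x z.
Proof. by rewrite /dotmx mulmxDr mxE. Qed.

Lemma dotmxNr n (x y : 'cV[R]_n) : dotmx x (- y) = - dotmx x y.
Proof. by rewrite /dotmx mulmxN mxE. Qed.

Lemma dotmx_mulmxl m n (A : 'M[R]_(m, n)) x y :
  dotmx (A *m x) y = dotmx x (A^T *m y).
Proof. by rewrite /dotmx trmx_mul mulmxA. Qed.

Lemma dotmx_sum n (x y : 'cV[R]_n) : dotmx x y = \sum_i x i 0 * y i 0.
Proof. by rewrite /dotmx mxE; apply: eq_bigr => i _; rewrite mxE. Qed.

Lemma measurable_dotmx n d (X : measurableType d) (g h : X -> 'cV[R]_n) :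
  measurable_fun setT g -> measurable_fun setT h ->
  measurable_fun setT (fun x => dotmx (g x) (h x)).
Proof.
move=> mg mh; apply: measurable_mx_coef.
by apply: measurable_mulmx => //; exact: measurable_trmx.
Qed.

End dotmx.

(** The translation formula of a centred Gaussian law of covariance Sigma. Only
the vectors Sigma t occur as translations, so that the formula passes to images
under arbitrary, possibly degenerate, matrices. *)
Definition cameron_martin (R : realType) n (mu : probability 'cV[R]_n R)
    (Sigma : 'M[R]_n) :=
  forall (t : 'cV[R]_n) (f : 'cV[R]_n -> \bar R),
  measurable_fun setT f -> (forall x, 0 <= f x)%E ->
  (\int[mu]_x f (x + Sigma *m t)%R =
   \int[mu]_x (f x * (expR (dotmx t x - dotmx t (Sigma *m t) / 2))%:E))%E.

Section cameron_martin_unique.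
Context {R : realType} {n : nat}.

Lemma measurable_expR_dotmx (t : 'cV[R]_n) (c : R) :
  measurable_fun setT (fun x : 'cV[R]_n => (expR (dotmx t x - c))%:E).
Proof.
apply/measurable_EFinP; apply: measurableT_comp => //.
by apply: measurable_funB => //; exact: measurable_dotmx.
Qed.

(** In the form [shift] below, with q the form of Sigma^-1, both laws are
translated by an arbitrary y. The weight in F cancels the factor that appears
when mu is translated by y; translating nu by x instead leaves the density of
a translate of mu, whose total mass is 1. *)
Lemma cameron_martin_unique (mu nu : probability 'cV[R]_n R) (Sigma : 'M[R]_n) :
  Sigma \in unitmx -> Sigma^T = Sigma ->
  cameron_martin mu Sigma -> cameron_martin nu Sigma ->
  forall A, measurable A -> mu A = nu A.
Proof.
move=> uS symS cmu cnu A mA.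
pose q (x y : 'cV[R]_n) := dotmx (invmx Sigma *m x) y.
have qC x y : q x y = q y x.
  by rewrite /q dotmx_mulmxl trmx_inv symS dotmxC.
have qDr x y z : q x (y + z) = q x y + q x z by exact: dotmxDr.
have qNr x y : q x (- y) = - q x y by exact: dotmxNr.
have mq d (X : measurableType d) (g h : X -> 'cV[R]_n) :
    measurable_fun setT g -> measurable_fun setT h ->
    measurable_fun setT (fun x => q (g x) (h x)).
  by move=> mg mh; apply: measurable_dotmx => //; exact: measurable_mulmx.
have shift (m : probability 'cV[R]_n R) : cameron_martin m Sigma ->
    forall y (f : 'cV[R]_n -> \bar R), measurable_fun setT f ->
    (forall x, 0 <= f x)%E -> (\int[m]_x f (x + y)%R =
    \int[m]_x (f x * (expR (q y x - q y y / 2))%:E))%E.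
  move=> cm y f mf f0; have := cm (invmx Sigma *m y) f mf f0.
  by rewrite mulKVmx.
have mI d (X : measurableType d) (g : X -> 'cV[R]_n) : measurable_fun setT g ->
    measurable_fun setT (fun x => \1_A (g x) : R).
  by move=> mg; apply: (measurableT_comp _ mg); exact: measurable_indic.
pose F (x y : 'cV[R]_n) : \bar R := (\1_A x * expR (q y y / 2 - q y x))%:E.
have F0 x y : (0 <= F x y)%E by rewrite lee_fin mulr_ge0 ?expR_ge0.
have mF d (X : measurableType d) (g h : X -> 'cV[R]_n) :
    measurable_fun setT g -> measurable_fun setT h ->
    measurable_fun setT (fun x => F (g x) (h x)).
  move=> mg mh; apply/measurable_EFinP; apply: measurable_funM; first exact: mI.
  apply: measurableT_comp => //; apply: measurable_funB; last exact: mq.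
  by apply: measurable_funM => //; exact: mq.
have mid : measurable_fun setT (@id 'cV[R]_n) by exact: measurable_id.
have intA (m : probability 'cV[R]_n R) : (\int[m]_x (\1_A x)%:E = m A)%E.
  by rewrite integral_indic// setIT.
have muA : (\int[nu]_y \int[mu]_x F (x + y)%R y = mu A)%E.
  rewrite (eq_integral (cst (mu A))); last first.
    move=> y _; have mFy := mF _ _ _ _ mid (measurable_cst y).
    rewrite (shift mu cmu y (F ^~ y) mFy (F0 ^~ y)).
    rewrite -intA; apply: eq_integral => x _.
    rewrite /F -EFinM -mulrA -expRD.
    by rewrite (_ : _ + _ = 0) ?expR0 ?mulr1//; ring.
  by rewrite integral_cst// [X in (_ * X)%E]probability_setT mule1.
have nuA : (\int[mu]_x \int[nu]_y F (x + y)%R y = nu A)%E.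
  pose H (x y : 'cV[R]_n) : \bar R := (\1_A y * expR (q y x - q y y / 2))%:E.
  transitivity (\int[mu]_x \int[nu]_y H x y)%E.
    apply: eq_integral => x _.
    pose G y := F y (y - x).
    have mG : measurable_fun setT G by apply: mF => //; exact: measurable_addmx.
    rewrite (eq_integral (fun y : 'cV[R]_n => G (y + x))); last first.
      by move=> y _; rewrite /G addrK [y + x]addrC.
    have G0 y : (0 <= G y)%E by exact: F0.
    rewrite (shift nu cnu x G mG G0); apply: eq_integral => y _.
    rewrite /G /F /H -EFinM -mulrA -expRD; congr (_ * expR _)%:E.
    rewrite qDr qNr [q (y - x) y]qC [q (y - x) x]qC !qDr !qNr.
    by rewrite [q x y]qC; field.
  rewrite (fubini_tonelli (fun z => H z.1 z.2)); last 2 first.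
  - apply/measurable_EFinP; apply: measurable_funM; first exact: mI.
    apply: measurableT_comp => //; apply: measurable_funB; first exact: mq.
    by apply: measurable_funM => //; exact: mq.
  - by move=> z; rewrite lee_fin mulr_ge0 ?expR_ge0.
  rewrite -intA; apply: eq_integral => y _ /=.
  transitivity ((\1_A y)%:E * \int[mu]_x (expR (q y x - q y y / 2))%:E)%E.
    by rewrite -ge0_integralZl//; exact: measurable_expR_dotmx.
  rewrite -[X in (_ * X)%E](_ : 1%E = _) ?mule1//.
  (* The weight has total mass 1: the translation formula for the constant 1. *)
  have := shift mu cmu y (cst 1%E) (measurable_cst _) (fun=> lee01).
  rewrite integral_cst// mul1e [X in X = _ -> _](probability_setT mu) => ->.
  by apply: eq_integral => x _; rewrite mul1e.
rewrite -muA -nuA.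
pose K (z : 'cV[R]_n * 'cV[R]_n) := F (z.2 + z.1) z.1.
have mK : measurable_fun setT K by apply: mF => //; exact: measurable_addmx.
have K0 z : (0 <= K z)%E by exact: F0.
exact: (@fubini_tonelli _ _ _ _ R nu mu K mK K0).
Qed.

End cameron_martin_unique.

(** * Stability of the Cameron-Martin formula *)

Section cameron_martin_stability.
Context {R : realType}.

Lemma eq_cameron_martin n (mu nu : probability 'cV[R]_n R) (Sigma : 'M[R]_n) :
  (forall A, measurable A -> mu A = nu A) ->
  cameron_martin mu Sigma -> cameron_martin nu Sigma.
Proof.
move=> E cmu t f mf f0.
have intE g : (\int[nu]_x g x = \int[mu]_x g x)%E.
  by apply: eq_measure_integral => A mA _; exact/esym/E.
by rewrite !intE; exact: cmu.
Qed.

(** Translating the image by M Sigma M^T t amounts to translating the source by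
Sigma (M^T t). *)
Lemma cameron_martin_linear m n (M : 'M[R]_(m, n)) (phi : 'cV[R]_n -> 'cV[R]_m)
    (mphi : measurable_fun setT phi) (mu : probability 'cV[R]_n R)
    (Sigma : 'M[R]_n) :
  (forall x, phi x = M *m x) -> cameron_martin mu Sigma ->
  cameron_martin (image_law mu mphi) (M *m Sigma *m M^T).
Proof.
move=> phiE cmu t f mf f0.
have mshift : measurable_fun setT
    (fun x : 'cV[R]_m => f (x + M *m Sigma *m M^T *m t)).
  apply: (measurableT_comp mf); exact: measurable_addmx.
have mtilt : measurable_fun setT (fun x : 'cV[R]_m => (f x *
    (expR (dotmx t x - dotmx t (M *m Sigma *m M^T *m t) / 2))%:E)%E).
  by apply: emeasurable_funM => //; exact: measurable_expR_dotmx.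
rewrite [LHS](ge0_integral_image_law mu mphi mshift)//.
rewrite [RHS](ge0_integral_image_law mu mphi mtilt); last first.
  by move=> x; rewrite mule_ge0 ?lee_fin ?expR_ge0.
have := cmu (M^T *m t) (f \o phi) (measurableT_comp mf mphi) (fun x => f0 _).
rewrite (eq_integral (fun x => f (phi x + M *m Sigma *m M^T *m t)%R)); last first.
  by move=> x _ /=; rewrite !phiE mulmxDr !mulmxA.
move=> ->; apply: eq_integral => x _ /=; rewrite !dotmx_mulmxl trmxK phiE.
by rewrite !mulmxA.
Qed.

Lemma measurable_col_mx_pair p n :
  measurable_fun setT (fun z : 'cV[R]_p * 'cV[R]_n => col_mx z.1 z.2).
Proof. exact: measurable_col_mx. Qed.

(** Tonelli: the inner variable is translated first, then the outer one. *)
Lemma cameron_martin_prod p n (mu : probability 'cV[R]_p R)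
    (nu : probability 'cV[R]_n R) (S : 'M[R]_p) (T : 'M[R]_n) :
  cameron_martin mu S -> cameron_martin nu T ->
  cameron_martin (image_law (mu \x nu)%E (@measurable_col_mx_pair p n))
    (block_mx S 0 0 T).
Proof.
move=> cmu cnu t f mf f0; set B := block_mx _ _ _ _.
pose a := usubmx t; pose b := dsubmx t.
have Bt : B *m t = col_mx (S *m a) (T *m b).
  by rewrite -[t]vsubmxK mul_block_col !mul0mx addr0 add0r.
have mshift : measurable_fun setT (fun x : 'cV[R]_(p + n) => f (x + B *m t)).
  by apply: (measurableT_comp mf); exact: measurable_addmx.
pose e (x : 'cV[R]_(p + n)) := (expR (dotmx t x - dotmx t (B *m t) / 2))%:E.
have mfe : measurable_fun setT (fun x => f x * e x)%E.
  by apply: emeasurable_funM => //; exact: measurable_expR_dotmx.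
have fe0 x : (0 <= f x * e x)%E by rewrite mule_ge0 ?lee_fin ?expR_ge0.
rewrite [LHS](ge0_integral_image_law _ (@measurable_col_mx_pair p n) mshift)//.
rewrite [RHS](ge0_integral_image_law _ (@measurable_col_mx_pair p n) mfe fe0).
pose ea (x : 'cV[R]_p) := (expR (dotmx a x - dotmx a (S *m a) / 2))%:E.
pose eb (y : 'cV[R]_n) := (expR (dotmx b y - dotmx b (T *m b) / 2))%:E.
have eE x y : e (col_mx x y) = (ea x * eb y)%E.
  rewrite /e /ea /eb -EFinM -expRD Bt -[t]vsubmxK /dotmx tr_col_mx !mul_row_col.
  by rewrite !mxE; congr (expR _)%:E; field.
pose h x := (\int[nu]_y (f (col_mx x y) * eb y))%E.
have mg : measurable_fun setT
    (fun z : 'cV[R]_p * 'cV[R]_n => f (col_mx z.1 z.2) * eb z.2)%E.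
  apply: emeasurable_funM.
    by apply: (measurableT_comp mf); exact: measurable_col_mx_pair.
  by apply: (measurableT_comp (measurable_expR_dotmx _ _)); exact: measurable_snd.
have g0 z : (0 <= f (col_mx z.1 z.2) * eb z.2)%E.
  by rewrite mule_ge0 ?lee_fin ?expR_ge0.
have mh : measurable_fun setT h.
  exact: (measurable_fun_fubini_tonelli_F
    (fun z : 'cV[R]_p * 'cV[R]_n => f (col_mx z.1 z.2) * eb z.2)%E).
have h0 x : (0 <= h x)%E by apply: integral_ge0 => y _; exact: (g0 (x, y)).
have mf1 x : measurable_fun setT (fun y : 'cV[R]_n => f (col_mx x y)).
  by apply: (measurableT_comp mf); exact: measurable_col_mx.
have mcol := @measurable_col_mx_pair p n.
rewrite (fubini_tonelli1 _ (measurableT_comp mshift mcol)) => [|z]; last exact: f0.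
rewrite (fubini_tonelli1 _ (measurableT_comp mfe mcol)) => [|z]; last exact: fe0.
rewrite /fubini_F/=.
transitivity (\int[mu]_x h (x + S *m a)%R)%E.
  apply: eq_integral => x _; rewrite /h.
  rewrite -(cnu b _ (mf1 _) (fun y => f0 _)).
  by apply: eq_integral => y _; rewrite Bt add_col_mx.
apply: (etrans (cmu a h mh h0)); apply: eq_integral => x _.
have gx0 y : setT y -> (0 <= f (col_mx x y) * eb y)%E.
  by move=> _; exact: (g0 (x, y)).
have mgx : measurable_fun setT (fun y => f (col_mx x y) * eb y)%E.
  by apply: emeasurable_funM => //; exact: measurable_expR_dotmx.
have ea0 : (0 <= ea x)%E by rewrite lee_fin expR_ge0.
apply: (etrans (esym (ge0_integralZr nu measurableT mgx gx0 ea0))).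
by apply: eq_integral => y _; rewrite eE -muleA [(eb _ * _)%E]muleC.
Qed.

End cameron_martin_stability.

(** * Products of normal laws *)

Section fprod_coordinates.
Context {d} {T : measurableType d} {R : realType} {I : finType}.
Implicit Types (P : I -> probability T R) (B : I -> set T).

Definition rect B : set {ffun I -> T} := [set y | forall i, B i (y i)].

Lemma measurable_rect B : (forall i, measurable (B i)) -> measurable (rect B).
Proof.
move=> mB; rewrite (_ : rect B =
    \bigcap_(i in setT) ((fun y : {ffun I -> T} => y i) @^-1` B i)); last first.
  by apply/seteqP; split => y /= yB i; [move=> _|]; exact: yB.
apply: fin_bigcap_measurable => [|i _]; first exact: finite_finset.
by rewrite -[X in measurable X]setTI; exact: measurable_ffun_eval.
Qed.

(** The boxes form a pi-system that generates the product sigma-algebra. *)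
Lemma rect_measure_unique (mu nu : probability {ffun I -> T} R) :
  (forall B, (forall i, measurable (B i)) -> mu (rect B) = nu (rect B)) ->
  forall A, measurable A -> mu A = nu A.
Proof.
move=> E A mA.
pose G := [set rect B | B in [set B | forall i, measurable (B i)]].
apply: (@measure_unique _ R _ G (fun=> setT)) => //.
- apply/seteqP; split => [C|].
  + apply: smallest_sub; first exact: smallest_sigma_algebra.
    move=> _ [i _ [C0 mC0 <-]]; apply: sub_sigma_algebra.
    exists (fun j => if j == i then C0 else setT).
      by move=> j; case: ifP.
    apply/seteqP; split => y /=.
      by move=> /(_ i); rewrite eqxx.
    by move=> Cy j; case: eqP => // ->.
  + apply: smallest_sub; first exact: sigma_algebra_measurable.
    by move=> _ [B mB <-]; exact: measurable_rect.
- move=> _ _ [B mB <-] [C mC <-]; exists (fun i => B i `&` C i).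
    by move=> i; exact: measurableI.
  apply/seteqP; split => y /=.
    by move=> BC; split => i; have [] := BC i.
  by move=> [By Cy] i; split; [exact: By|exact: Cy].
- by move=> _; exists (fun=> setT) => //; apply/seteqP; split.
- by rewrite bigcup_const.
- by move=> _ [B mB <-]; exact: E.
- by move=> _; rewrite [X in (X < _)%E]probability_setT ltry.
Qed.

(** Redrawing one coordinate independently does not change the product law. This
isolates a single coordinate of the iterated integral that defines [fprod]. *)
Lemma fprod_resample P i A : measurable A ->
  fprod P A =
  (fprod P \x P i)%E ((fun z => ffun_upd z.1 i z.2) @^-1` A).
Proof.
move: A; have mupd := @measurable_ffun_upd _ T I i.
apply: (rect_measure_unique (nu := image_law (fprod P \x P i)%E mupd)) => B mB.
rewrite [RHS]/=.
(* The redrawn coordinate forgets its first value. *)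
pose B' j := if j == i then setT else B j.
have mB' j : measurable (B' j) by rewrite /B'; case: ifP.
transitivity ((fprod P \x P i)%E (rect B' `*` B i)); last first.
  congr (_ _); apply/seteqP; split => [[y t] [/= By Bt] j|[y t] /= Byt].
    rewrite /= ffunE; case: eqP => [->//|/eqP ji].
    by have := By j; rewrite /B' (negPf ji).
  split => [j|]; last by have := Byt i; rewrite ffunE eqxx.
  by rewrite /= /B'; case: ifPn => // ji; have := Byt j; rewrite ffunE (negPf ji).
rewrite product_measure1E//; last exact: measurable_rect.
rewrite [LHS](fprod_rect P mB) [X in (X * _)%E](fprod_rect P mB').
rewrite [LHS](bigD1 i)//= [in RHS](bigD1 i)//= muleC; congr (_ * _)%E.
rewrite /B' eqxx [X in (X * _)%E]probability_setT mul1e.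
by apply: eq_bigr => j /negPf ->.
Qed.

Lemma ge0_integral_fprod_resample P i (f : {ffun I -> T} -> \bar R) :
  measurable_fun setT f -> (forall y, 0 <= f y)%E ->
  (\int[fprod P]_y f y = \int[fprod P]_y \int[P i]_t f (ffun_upd y i t))%E.
Proof.
move=> mf f0; have mupd := @measurable_ffun_upd _ T I i.
rewrite (eq_measure_integral (image_law (fprod P \x P i)%E mupd)); last first.
  by move=> A mA _; exact: fprod_resample.
rewrite [LHS](ge0_integral_image_law _ mupd)//.
by rewrite (fubini_tonelli1 _ (measurableT_comp mf mupd)) => [|z]; last exact: f0.
Qed.

End fprod_coordinates.

Section fprod_normal.
Context {R : realType} {I : finType} (v : R).
Hypothesis v0 : 0 < v.

Definition noise : probability {ffun I -> R} R :=
  fprod (fun=> normal_law 0 v : probability R R).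

Lemma measurable_ffun_add (m : I -> R) :
  measurable_fun setT (fun y : {ffun I -> R} => [ffun i => m i + y i]).
Proof.
apply: measurable_ffunP => i.
rewrite (_ : (fun y => _) = fun y : {ffun I -> R} => m i + y i); last first.
  by apply/funext => y; rewrite ffunE.
by apply: measurable_funD => //; exact: measurable_ffun_eval.
Qed.

(** The observations of the linear model are their means plus a centred noise
whose law does not depend on the means. *)
Lemma fprod_normal_shift (m : I -> R) (A : set {ffun I -> R}) : measurable A ->
  fprod (fun i => normal_law (m i) v : probability R R) A =
  noise [set y | A [ffun i => m i + y i]].
Proof.
move: A; apply: (rect_measure_unique
  (nu := image_law noise (measurable_ffun_add m))) => B mB.
rewrite [LHS](fprod_rect _ mB) [RHS]/=.
have mshift i : measurable [set x | B i (m i + x)].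
  rewrite -[X in measurable X]setTI.
  have ms : measurable_fun setT (fun x => m i + x) by exact: measurable_funD.
  exact: ms.
transitivity (noise (rect (fun i => [set x | B i (m i + x)]))).
  rewrite [RHS](fprod_rect _ mshift); apply: eq_bigr => i _.
  exact: normal_law_shift.
congr (_ _); apply/seteqP; split => y /= By i; have := By i; rewrite ffunE.
all: by [].
Qed.

(** After redrawing coordinate i, the translated coordinate is an independent
N(0, v) variable, to which the formula on the line applies. *)
Lemma cameron_martin_noise1 i (t : R) (f : {ffun I -> R} -> \bar R) :
  measurable_fun setT f -> (forall y, 0 <= f y)%E ->
  (\int[noise]_y f (ffun_upd y i (y i + v * t)%R) =
   \int[noise]_y (f y * (expR (t * y i - v * t ^+ 2 / 2))%:E))%E.
Proof.
move=> mf f0.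
have myi := @measurable_ffun_eval _ R I i.
have mupd : measurable_fun setT
    (fun y : {ffun I -> R} => ffun_upd y i (y i + v * t)).
  apply: (measurableT_comp (measurable_ffun_upd i)
    (g := fun y : {ffun I -> R} => (y, y i + v * t))).
  by apply: measurable_fun_pair => //; exact: measurable_funD.
have me : measurable_fun setT
    (fun y : {ffun I -> R} => f y * (expR (t * y i - v * t ^+ 2 / 2))%:E)%E.
  apply: emeasurable_funM => //; apply/measurable_EFinP/measurableT_comp => //.
  by apply: measurable_funB => //; exact: measurable_funM.
have fe0 y : (0 <= f y * (expR (t * y i - v * t ^+ 2 / 2))%:E)%E.
  by rewrite mule_ge0// lee_fin expR_ge0.
rewrite [LHS](ge0_integral_fprod_resample _ i (measurableT_comp mf mupd)
  (fun y => f0 _)).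
rewrite [RHS](ge0_integral_fprod_resample _ i me fe0).
apply: eq_integral => y _.
have mfi : measurable_fun setT (fun s => f (ffun_upd y i s)).
  apply: (measurableT_comp mf); apply: (measurableT_comp (measurable_ffun_upd i)
    (g := fun s => (y, s))).
  exact: pair1_measurable.
have := @cameron_martin_normal_law R v t (fun s => f (ffun_upd y i s)) v0 mfi
  (fun s => f0 _).
have updi s : ffun_upd y i s i = s by rewrite ffunE eqxx.
have updd s s' : ffun_upd (ffun_upd y i s) i s' = ffun_upd y i s'.
  by apply/ffunP => j; rewrite !ffunE; case: eqP.
move=> E; apply: (etrans _ (etrans E _)); apply: eq_integral => s _ /=.
  by rewrite updd updi.
by rewrite updi.
Qed.

(** The coordinates are translated one after the other; the exponent collected
from the coordinates already treated does not involve the next one. *)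
Lemma cameron_martin_noise (t : I -> R) (f : {ffun I -> R} -> \bar R) :
  measurable_fun setT f -> (forall y, 0 <= f y)%E ->
  (\int[noise]_y f [ffun i => y i + v * t i]%R =
   \int[noise]_y
     (f y * (expR (\sum_i (t i * y i - v * t i ^+ 2 / 2)%R))%:E))%E.
Proof.
move=> mf f0.
pose shift (s : seq I) (y : {ffun I -> R}) : {ffun I -> R} :=
  [ffun i => if i \in s then y i + v * t i else y i].
pose tilt (s : seq I) (y : {ffun I -> R}) : R :=
  \sum_(i <- s) (t i * y i - v * t i ^+ 2 / 2).
suff H s : uniq s -> forall g : {ffun I -> R} -> \bar R,
    measurable_fun setT g -> (forall y, 0 <= g y)%E ->
    (\int[noise]_y g (shift s y) = \int[noise]_y (g y * (expR (tilt s y))%:E))%E.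
  have := H (enum I) (enum_uniq I) f mf f0.
  under eq_integral => y _.
    rewrite (_ : shift _ _ = [ffun i => y i + v * t i]); last first.
      by apply/ffunP => i; rewrite !ffunE mem_enum.
    over.
  by move=> ->; apply: eq_integral => y _; rewrite /tilt big_enum.
elim: s => [_ g mg g0|i s ih /= /andP[iNs us] g mg g0].
  apply: eq_integral => y _; rewrite /tilt big_nil expR0 mule1; congr g.
  by apply/ffunP => i; rewrite ffunE.
have myi j := @measurable_ffun_eval _ R I j.
have mupd : measurable_fun setT
    (fun y : {ffun I -> R} => ffun_upd y i (y i + v * t i)).
  apply: (measurableT_comp (measurable_ffun_upd i)
    (g := fun y : {ffun I -> R} => (y, y i + v * t i))).
  by apply: measurable_fun_pair => //; exact: measurable_funD.
have mgt : measurable_fun setT (fun y => g y * (expR (tilt s y))%:E)%E.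
  apply: emeasurable_funM => //; apply/measurable_EFinP/measurableT_comp => //.
  apply: measurable_sum => j.
  by apply: measurable_funB => //; exact: measurable_funM.
have gt0 y : (0 <= g y * (expR (tilt s y))%:E)%E.
  by rewrite mule_ge0// lee_fin expR_ge0.
transitivity
    (\int[noise]_y (g (ffun_upd y i (y i + v * t i)%R) * (expR (tilt s y))%:E))%E.
  have := ih us (fun y : {ffun I -> R} => g (ffun_upd y i (y i + v * t i)))
    (measurableT_comp mg mupd) (fun y => g0 _).
  move=> <-; apply: eq_integral => y _; congr g; apply/ffunP => j.
  by rewrite !ffunE inE; case: eqP => [->|//]; rewrite (negPf iNs).
have := cameron_martin_noise1 i (t i) mgt gt0.
have tiltE (y : {ffun I -> R}) : tilt s (ffun_upd y i (y i + v * t i)) = tilt s y.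
  apply: eq_big_seq => j js; rewrite ffunE; case: eqP => // ji.
  by move: iNs; rewrite -ji js.
move=> E; apply: (etrans _ (etrans E _)); apply: eq_integral => y _.
  by rewrite tiltE.
rewrite -muleA -EFinM -expRD /tilt big_cons; congr (_ * (expR _)%:E)%E.
exact: addrC.
Qed.

Lemma measurable_ffun_col n (enu : 'I_n -> I) :
  measurable_fun setT (fun y : {ffun I -> R} => \col_i y (enu i)).
Proof.
apply: measurable_mxP => i j.
rewrite (_ : (fun y => _) = fun y : {ffun I -> R} => y (enu i)); last first.
  by apply/funext => y; rewrite mxE.
exact: measurable_ffun_eval.
Qed.

(** Serves twice: for an enumeration of the units of a design, and for the identity
of the index type, which gives the standard normal vector behind [gaussian]. *)
Lemma cameron_martin_noise_col n (enu : 'I_n -> I) : bijective enu ->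
  cameron_martin (image_law noise (measurable_ffun_col enu)) v%:M.
Proof.
move=> [enu' enuK enu'K] t f mf f0.
have mcol := measurable_ffun_col enu.
have mshift : measurable_fun setT (fun x : 'cV[R]_n => f (x + v%:M *m t)).
  by apply: (measurableT_comp mf); exact: measurable_addmx.
have mtilt : measurable_fun setT (fun x : 'cV[R]_n => (f x *
    (expR (dotmx t x - dotmx t (v%:M *m t) / 2))%:E)%E).
  by apply: emeasurable_funM => //; exact: measurable_expR_dotmx.
rewrite [LHS](ge0_integral_image_law noise mcol mshift)//.
rewrite [RHS](ge0_integral_image_law noise mcol mtilt); last first.
  by move=> x; rewrite mule_ge0 ?lee_fin ?expR_ge0.
have := cameron_martin_noise (fun i => t (enu' i) 0) (measurableT_comp mf mcol)
  (fun y => f0 _).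
move=> E; apply: (etrans _ (etrans E _)); apply: eq_integral => y _ /=.
  by congr f; apply/colP => i; rewrite mul_scalar_mx !mxE ffunE enuK.
congr (_ * (expR _)%:E)%E.
rewrite (reindex enu) /=; last by exists enu' => i _; rewrite ?enuK ?enu'K.
rewrite !dotmx_sum mulr_suml -sumrB; apply: eq_bigr => i _.
by rewrite mul_scalar_mx !mxE enuK; ring.
Qed.

End fprod_normal.

(** * Positive definite matrices and Gaussian laws *)

Section positive_definite.
Context {R : realType}.

Lemma dotmxZr n (x y : 'cV[R]_n) c : dotmx x (c *: y) = c * dotmx x y.
Proof. by rewrite /dotmx -scalemxAr mxE. Qed.

Lemma dotmx_col_mx m n (x x' : 'cV[R]_m) (y y' : 'cV[R]_n) :
  dotmx (col_mx x y) (col_mx x' y') = dotmx x x' + dotmx y y'.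
Proof. by rewrite /dotmx tr_col_mx mul_row_col mxE. Qed.

Definition posdef n (S : 'M[R]_n) :=
  S^T = S /\ forall x : 'cV[R]_n, x != 0 -> 0 < dotmx x (S *m x).

Lemma dotmx_gt0 n (x : 'cV[R]_n) : x != 0 -> 0 < dotmx x x.
Proof.
move=> x0; rewrite dotmx_sum lt_def sumr_ge0 ?andbT; last first.
  by move=> i _; rewrite -expr2 sqr_ge0.
apply: contra x0; rewrite psumr_eq0 => [/allP x0|i _]; last first.
  by rewrite -expr2 sqr_ge0.
apply/eqP/colP => i; rewrite mxE; apply/eqP.
by have := x0 i; rewrite mem_index_enum mulf_eq0 orbb => /(_ isT).
Qed.

Lemma dotmx_ge0 n (x : 'cV[R]_n) : 0 <= dotmx x x.
Proof. by rewrite dotmx_sum sumr_ge0// => i _; rewrite -expr2 sqr_ge0. Qed.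

Lemma posdef_unit n (S : 'M[R]_n) : posdef S -> S \in unitmx.
Proof.
move=> [symS posS]; rewrite -row_free_unit -kermx_eq0; apply/negPn/negP.
move=> /rowV0Pn[x /sub_kermxP xS0 x0].
have := posS x^T; rewrite -(inj_eq trmx_inj) trmxK trmx0 => /(_ x0).
by rewrite /dotmx trmxK mulmxA xS0 mul0mx mxE ltxx.
Qed.

(** Covers the predictive covariance tau^2 X X^T + s^2 I and, for A = X^T, the
matrix X^T X + lambda I of the ridge estimator. *)
Lemma posdef_gram_scalar m n (A : 'M[R]_(m, n)) (b c : R) : 0 <= b -> 0 < c ->
  posdef (b *: (A *m A^T) + c%:M).
Proof.
move=> b0 c0; split=> [|x x0].
  by rewrite linearD linearZ/= trmx_mul trmxK tr_scalar_mx.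
rewrite mulmxDl dotmxDr -scalemxAl mul_scalar_mx.
rewrite !dotmxZr ltr_wpDl ?mulr_gt0 ?dotmx_gt0// mulr_ge0//.
by rewrite -mulmxA dotmxC dotmx_mulmxl dotmx_ge0.
Qed.

Lemma posdef_invmx n (S : 'M[R]_n) : posdef S -> posdef (invmx S).
Proof.
move=> pS; have uS := posdef_unit pS; have [symS posS] := pS.
split=> [|x x0]; first by rewrite trmx_inv symS.
have y0 : invmx S *m x != 0.
  by apply: contra x0 => /eqP x0; rewrite -(mulKVmx uS x) x0 mulmx0.
by have := posS _ y0; rewrite mulKVmx// dotmxC.
Qed.

Lemma posdefZ n (S : 'M[R]_n) c : 0 < c -> posdef S -> posdef (c *: S).
Proof.
move=> c0 [symS posS]; split=> [|x x0]; first by rewrite linearZ/= symS.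
by rewrite -scalemxAl dotmxZr mulr_gt0// posS.
Qed.

(** Cholesky: with S = [[a, v^T], [v, T]] the Schur complement T - v v^T / a is
positive definite, as its quadratic form at y is that of S at
(- (v . y) / a, y); a factor L of it gives the factor [[sqrt a, 0], [v / sqrt a, L]]
of S. It shows that [mxsqrt] is meaningful on the covariances used here. *)
Lemma posdef_sqrt n (S : 'M[R]_n) :
  posdef S -> exists A : 'M[R]_n, A *m A^T = S.
Proof.
elim: n S => [|n ih] S; first by exists 0; rewrite [LHS]flatmx0 [RHS]flatmx0.
rewrite -[n.+1]/(1 + n)%N in S *; move=> [symS posS].
pose a := S 0 0; pose v : 'cV[R]_n := dlsubmx S; pose T := drsubmx S.
have SE : S = block_mx a%:M v^T v T.
  rewrite -[LHS]submxK; congr block_mx.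
    rewrite [LHS]mx11_scalar; congr _%:M; rewrite !mxE.
    by congr (S _ _); apply/val_inj.
  by rewrite /v trmx_dlsub symS.
have symT : T^T = T by rewrite /T trmx_drsub symS.
have quad k (y : 'cV[R]_n) : dotmx (col_mx k%:M y) (S *m col_mx k%:M y) =
    a * k ^+ 2 + 2 * k * dotmx v y + dotmx y (T *m y).
  rewrite SE mul_block_col dotmx_col_mx !dotmxDr [v *m _]mul_mx_scalar dotmxZr.
  rewrite [dotmx y v]dotmxC.
  rewrite /dotmx tr_scalar_mx !mul_scalar_mx !mxE /=.
  rewrite mulr1n; ring.
have a0 : 0 < a.
  have := posS (col_mx 1%:M 0); rewrite quad mulmx0 expr1n !mulr1.
  rewrite -[X in dotmx v X](scale0r 0) -[X in dotmx 0 X](scale0r 0) !dotmxZr.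
  rewrite !mul0r mulr0 !addr0; apply.
  apply/eqP => /colP/(_ (lshift n 0)); rewrite col_mxEu !mxE => /eqP.
  by rewrite oner_eq0.
pose U := T - a^-1 *: (v *m v^T).
have [|L LE] := ih U.
  split=> [|y y0].
    by rewrite /U linearB linearZ/= trmx_mul trmxK symT.
  have := posS (col_mx (- (a^-1 * dotmx v y))%:M y); rewrite quad.
  have -> : col_mx (- (a^-1 * dotmx v y))%:M y != 0.
    by apply: contra y0 => /eqP; rewrite -col_mx0 => /eq_col_mx[_ ->].
  move=> /(_ isT); congr (0 < _).
  rewrite /U mulmxBl dotmxDr dotmxNr -scalemxAl dotmxZr -mulmxA.
  rewrite [v^T *m y]mx11_scalar mul_mx_scalar dotmxZr [dotmx y v]dotmxC.
  rewrite -/(dotmx v y).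
  by field; rewrite gt_eqF.
exists (block_mx (Num.sqrt a)%:M 0 ((Num.sqrt a)^-1 *: v) L).
have sa : Num.sqrt a != 0 by rewrite gt_eqF// sqrtr_gt0.
rewrite SE tr_block_mx mulmx_block !trmx0 !mul0mx !mulmx0 !addr0 tr_scalar_mx.
rewrite LE linearZ/= -!scalemxAl -!scalemxAr mul_mx_scalar !mul_scalar_mx !scalerA.
rewrite mulVf// !scale1r scale_scalar_mx -expr2 sqr_sqrtr ?ltW//.
by rewrite -invfM -expr2 sqr_sqrtr ?ltW// /U addrC subrK mul_mx_scalar scalerK.
Qed.

End positive_definite.

Section gaussian_law.
Context {R : realType} {n : nat}.
Implicit Types (S : 'M[R]_n) (m : 'cV[R]_n).

Lemma gaussian_shift m S (A : set 'cV[R]_n) :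
  gaussian m S A = gaussian 0 S [set x | A (m + x)].
Proof.
rewrite /gaussian /=; congr (std_normal _); apply/seteqP.
by split => z /=; rewrite /affine_map add0r.
Qed.

Lemma measurable_mulmxl p q (M : 'M[R]_(p, q)) :
  measurable_fun setT (fun x : 'cV[R]_q => M *m x).
Proof. exact: measurable_mulmx. Qed.

(** The law is the image of the standard normal vector under a square root of S. *)
Lemma cameron_martin_gaussian S : posdef S -> cameron_martin (gaussian 0 S) S.
Proof.
move=> /posdef_sqrt[A AS]; have sqrtS : mxsqrt S *m (mxsqrt S)^T = S.
  exact: (@xgetPex _ 0 [set A : 'M[R]_n | A *m A^T = S] (ex_intro _ A AS)).
have bij_id : bijective (@id 'I_n) by exists id.
have cm := @cameron_martin_linear R n n (mxsqrt S) _ (measurable_mulmxl (mxsqrt S))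
  _ _ (fun=> erefl) (cameron_martin_noise_col (@ltr01 R) bij_id).
rewrite mulmx1 sqrtS in cm; apply: eq_cameron_martin cm => B mB.
rewrite /gaussian /=; congr (std_normal _).
by apply/seteqP; split => z /=; rewrite /affine_map add0r.
Qed.

End gaussian_law.

(** * Gaussian regression in coordinates *)

Lemma product_measure_section d1 d2 (T1 : measurableType d1)
    (T2 : measurableType d2) (R : realType) (mu : probability T1 R)
    (nu : probability T2 R) (S : set T1) (C : T1 -> set T2) :
  ((mu \x nu) [set z | S z.1 /\ C z.1 z.2] = \int[mu]_(x in S) nu (C x))%E.
Proof.
rewrite [RHS]integral_mkcond; apply: eq_integral => x _ /=; rewrite patchE.
case: ifPn => [/set_mem Sx|/negP Sx].
  by congr (nu _); apply/seteqP; split => y; rewrite /xsection /= inE /=; [case|].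
rewrite (_ : xsection _ _ = set0) ?measure0//.
by apply/seteqP; split => y //; rewrite /xsection /= inE /= => -[/mem_set].
Qed.

Section gaussian_regression.
Context {R : realType} {n p : nat} (X : 'M[R]_(n, p)) (tau2 s2 : R).
Hypotheses (tau2_gt0 : 0 < tau2) (s2_gt0 : 0 < s2).

Local Notation lam := (s2 / tau2).
Local Notation K := (X^T *m X + lam%:M).
Local Notation M := (invmx K *m X^T).
Local Notation Sy := (tau2 *: (X *m X^T) + s2%:M).
Local Notation Sp := (s2 *: invmx K).

Let lam_gt0 : 0 < lam. Proof. by rewrite divr_gt0. Qed.

Let posdef_K : posdef K.
Proof.
by have := posdef_gram_scalar X^T ler01 lam_gt0; rewrite scale1r trmxK.
Qed.

Lemma posdef_predictive : posdef Sy.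
Proof. exact: posdef_gram_scalar (ltW tau2_gt0) s2_gt0. Qed.

Lemma posdef_posterior : posdef Sp.
Proof. exact: posdefZ s2_gt0 (posdef_invmx posdef_K). Qed.

Let tr_invK : (invmx K)^T = invmx K.
Proof. by rewrite trmx_inv (proj1 posdef_K). Qed.

Let tau2K : tau2 *: K = tau2 *: (X^T *m X) + s2%:M.
Proof.
by rewrite scalerDr scale_scalar_mx mulrC divfK// gt_eqF.
Qed.

(** From X^T (X X^T + lambda I) = (X^T X + lambda I) X^T. *)
Lemma ridge_gain_cov : M *m Sy = tau2 *: X^T.
Proof.
have uK := posdef_unit posdef_K.
rewrite -mulmxA.
have -> : X^T *m (tau2 *: (X *m X^T) + s2%:M) = (tau2 *: K) *m X^T.
  rewrite tau2K mulmxDr mulmxDl -scalemxAr -scalemxAl !mulmxA.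
  by rewrite mul_mx_scalar mul_scalar_mx.
by rewrite -scalemxAl -scalemxAr mulKmx.
Qed.

(** The prior covariance is the part explained by the observation plus the
posterior covariance. *)
Lemma ridge_cov_decomp : M *m Sy *m M^T + Sp = tau2%:M.
Proof.
have uK := posdef_unit posdef_K.
rewrite ridge_gain_cov trmx_mul trmxK tr_invK -scalemxAl mulmxA.
rewrite scalemxAl -[s2 *: _]mul_scalar_mx -mulmxDl -tau2K -scalemxAl.
by rewrite mulmxV// scale_scalar_mx mulr1.
Qed.

Lemma measurable_usubmx :
  measurable_fun setT (usubmx : 'cV[R]_(p + n) -> 'cV[R]_p).
Proof.
apply: measurable_mxP => i j.
rewrite (_ : (fun w => _) = fun w : 'cV[R]_(p + n) => w (lshift n i) j); last first.
  by apply/funext => w; rewrite mxE.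
exact: measurable_mx_entry.
Qed.

Lemma measurable_dsubmx :
  measurable_fun setT (dsubmx : 'cV[R]_(p + n) -> 'cV[R]_n).
Proof.
apply: measurable_mxP => i j.
rewrite (_ : (fun w => _) = fun w : 'cV[R]_(p + n) => w (rshift p i) j); last first.
  by apply/funext => w; rewrite mxE.
exact: measurable_mx_entry.
Qed.

(** Both sides are the probability that the parameter lies in S and the
observation in C: on the left the pair is (a, X a + noise), on the right it is
(M y + z, y) with y drawn from the predictive law. Both pairs are linear images
of independent Gaussian vectors and have the covariance [cov]. *)
Lemma gaussian_bayes (rho : probability 'cV[R]_p R) (nu : probability 'cV[R]_n R)
    (S : set 'cV[R]_p) (C : set 'cV[R]_n) :
  cameron_martin rho tau2%:M -> cameron_martin nu s2%:M ->
  measurable S -> measurable C ->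
  (\int[rho]_(a in S) nu [set x | C (X *m a + x)]%R =
   \int[gaussian 0 Sy%R]_(y in C) gaussian (M *m y)%R Sp%R S)%E.
Proof.
move=> cmrho cmnu mS mC.
(* (a, x) |-> (a, X a + x) and (y, z) |-> (M y + z, y). *)
pose A1 : 'M[R]_(p + n) := block_mx 1%:M 0 X 1%:M.
pose A2 : 'M[R]_(p + n, n + p) := block_mx M 1%:M 1%:M 0.
pose J1 := image_law (image_law (rho \x nu)%E (@measurable_col_mx_pair R p n))
  (measurable_mulmxl A1).
pose J2 := image_law (image_law (gaussian 0 Sy%R \x gaussian 0 Sp%R)%E
  (@measurable_col_mx_pair R n p)) (measurable_mulmxl A2).
pose cov : 'M[R]_(p + n) :=
  block_mx tau2%:M (tau2 *: X^T) (tau2 *: X) Sy.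
have covE : A1 *m block_mx tau2%:M 0 0 s2%:M *m A1^T = cov.
  rewrite /A1 tr_block_mx !mulmx_block !trmx0 !trmx1 !mul1mx !mulmx1 !mul0mx.
  rewrite !(mulmx0, mul0mx, addr0, add0r) mul_mx_scalar mul_scalar_mx.
  by rewrite -scalemxAl.
have cm1 : cameron_martin J1 cov.
  rewrite -covE; apply: cameron_martin_linear => //.
  exact: cameron_martin_prod.
have cm2 : cameron_martin J2 cov.
  have := cameron_martin_linear (measurable_mulmxl A2) (fun=> erefl)
    (cameron_martin_prod (cameron_martin_gaussian posdef_predictive)
      (cameron_martin_gaussian posdef_posterior)).
  congr cameron_martin.
  rewrite /A2 tr_block_mx !mulmx_block !trmx0 !trmx1 !mul1mx !mulmx1 !mul0mx.
  rewrite !(mulmx0, mul0mx, addr0, add0r) ridge_cov_decomp ridge_gain_cov.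
  have -> : Sy *m M^T = tau2 *: X.
    apply: trmx_inj; rewrite trmx_mul trmxK (proj1 posdef_predictive).
    by rewrite ridge_gain_cov linearZ.
  by [].
have ucov : cov \in unitmx.
  have uA1 : A1 \in unitmx by rewrite unitmxE det_lblock !det1 mulr1 unitr1.
  rewrite -covE !unitmx_mul unitmx_tr uA1 andbT/= unitmxE det_lblock !det_scalar.
  by rewrite unitfE mulf_neq0// expf_neq0// gt_eqF.
have symcov : cov^T = cov.
  rewrite /cov tr_block_mx tr_scalar_mx !linearZ/= trmxK.
  by rewrite (proj1 posdef_predictive).
pose D : set 'cV[R]_(p + n) := [set w | S (usubmx w) /\ C (dsubmx w)].
have mD : measurable D.
  rewrite (_ : D = usubmx @^-1` S `&` dsubmx @^-1` C)//.
  by apply: measurableI; rewrite -[X in measurable X]setTI;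
    [exact: measurable_usubmx|exact: measurable_dsubmx].
have := cameron_martin_unique ucov symcov cm1 cm2 mD.
rewrite [X in X = _ -> _](_ : _ =
    (rho \x nu)%E [set z | S z.1 /\ C (X *m z.1 + z.2)]); last first.
  congr ((rho \x nu)%E _); apply/seteqP; split => z /=;
  by rewrite /D /= mul_block_col !mul1mx mul0mx addr0 col_mxKu col_mxKd.
rewrite [X in _ = X -> _](_ : _ = (gaussian 0 Sy \x gaussian 0 Sp)%E
    [set z | C z.1 /\ S (M *m z.1 + z.2)]); last first.
  congr ((gaussian 0 Sy \x gaussian 0 Sp)%E _); apply/seteqP; split => z /=;
  rewrite /D /= mul_block_col !mul1mx mul0mx addr0 col_mxKu col_mxKd;
  by move=> [].
move=> E.
have Erho := product_measure_section rho nu S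
  (fun a => [set x | C (X *m a + x)]).
apply: (etrans (esym Erho)); apply: (etrans E).
apply: (etrans (product_measure_section _ _ _
  (fun y => [set x | S (M *m y + x)]))).
by apply: eq_integral => y _; rewrite gaussian_shift.
Qed.

End gaussian_regression.

(** * Mean of a Gaussian law *)

Section image_law_integrable.
Context {d1 d2} {T : measurableType d1} {T' : measurableType d2} {R : realType}.

(** Q is only required to coincide with the image on measurable sets, since the
laws at hand are given by other expressions. *)
Lemma integral_image_law (P : probability T R) (f : T -> T')
    (mf : measurable_fun setT f) (Q : {measure set T' -> \bar R})
    (g : T' -> \bar R) :
  (forall A, measurable A -> Q A = P (f @^-1` A)) ->
  measurable_fun setT g -> P.-integrable setT (fun x => g (f x)) ->
  Q.-integrable setT g /\ (\int[Q]_y g y = \int[P]_x g (f x))%E.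
Proof.
move=> QE mg ig.
have intE h : (\int[Q]_y h y = \int[image_law P mf]_y h y)%E.
  by apply: eq_measure_integral => A mA _; rewrite QE.
split; last by rewrite intE integral_distribution.
apply/integrableP; split => //; rewrite intE.
by have /integrableP[] := integrable_pushforward mf mg ig measurableT.
Qed.

End image_law_integrable.

Section gaussian_mean.
Context {R : realType} {n : nat} (S : 'M[R]_n).
Hypothesis posS : posdef S.

Let cmS := cameron_martin_gaussian posS.

(** The translation formula for the constant function 1. *)
Lemma gaussian_exp_moment (t : 'cV[R]_n) :
  (\int[gaussian 0 S]_x (expR (dotmx t x))%:E =
   (expR (dotmx t (S *m t) / 2))%:E)%E.
Proof.
set c := dotmx t (S *m t) / 2.
have := cmS t (measurable_cst 1%E) (fun=> lee01).
rewrite integral_cst// mul1e [X in X = _ -> _](probability_setT (gaussian 0 S)).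
move=> E; transitivity
    (\int[gaussian 0 S]_x ((expR c)%:E * (expR (dotmx t x - c))%:E))%E.
  by apply: eq_integral => x _; rewrite -EFinM -expRD addrC subrK.
rewrite ge0_integralZl//; last exact: measurable_expR_dotmx.
rewrite -[RHS]mule1 E; congr (_ * _)%E.
by apply: eq_integral => x _; rewrite mul1e.
Qed.

(** Dominated by exponential moments: |x| <= exp x + exp (- x). *)
Lemma gaussian_coord_integrable (j : 'I_n) :
  (gaussian 0 S).-integrable setT (fun x => (x j 0)%:E).
Proof.
pose t : 'cV[R]_n := delta_mx j 0.
have dott x : dotmx t x = x j 0.
  rewrite dotmx_sum (bigD1 j)//= mxE !eqxx mul1r big1 ?addr0// => i ij.
  by rewrite mxE (negPf ij) mul0r.
have dotNt x : dotmx (- t) x = - x j 0 by rewrite dotmxC dotmxNr dotmxC dott.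
have me (u : 'cV[R]_n) :
    measurable_fun setT (fun x : 'cV[R]_n => (expR (dotmx u x))%:E).
  by apply/measurable_EFinP/measurableT_comp => //; exact: measurable_dotmx.
apply/integrableP; split.
  by apply/measurable_EFinP; exact: measurable_mx_entry.
apply: (@le_lt_trans _ _ (\int[gaussian 0 S]_x
    ((expR (dotmx t x))%:E + (expR (dotmx (- t) x))%:E))%E).
  apply: ge0_le_integral => //.
  - apply/measurableT_comp => //; apply/measurable_EFinP.
    exact: measurable_mx_entry.
  - exact: emeasurable_funD.
  - move=> x _; rewrite dott dotNt -EFinD lee_fin ler_norml.
    have := expR_ge1Dx (x j 0); have := expR_ge1Dx (- x j 0).
    have := expR_ge0 (x j 0); have := expR_ge0 (- x j 0); lra.
by rewrite ge0_integralD// !gaussian_exp_moment ltry.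
Qed.

(** x and - x have the same covariance, hence the same law. *)
Lemma gaussian_coord_mean0 (j : 'I_n) :
  (\int[gaussian 0 S]_x (x j 0)%:E = 0)%E.
Proof.
have mN := measurable_mulmxl (- 1%:M : 'M[R]_n).
have mj : measurable_fun setT (fun x : 'cV[R]_n => (x j 0)%:E).
  by apply/measurable_EFinP; exact: measurable_mx_entry.
have intj := gaussian_coord_integrable j.
have NE (x : 'cV[R]_n) : ((- 1%:M *m x) j 0)%:E = (- (x j 0)%:E)%E.
  by rewrite mulNmx mul1mx mxE.
have intN : (gaussian 0 S).-integrable setT
    ((fun x : 'cV[R]_n => (x j 0)%:E) \o mulmx (- 1%:M)).
  by apply: eq_integrable (integrableN intj) => // x _ /=; rewrite NE.
have cmN : cameron_martin (image_law (gaussian 0 S) mN) S.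
  rewrite -[S in X in cameron_martin _ X](_ : - 1%:M *m S *m (- 1%:M)^T = S).
    exact: cameron_martin_linear cmS.
  by rewrite linearN/= trmx1 mulNmx mulmxN mul1mx mulmx1 opprK.
have symE := cameron_martin_unique (posdef_unit posS) (proj1 posS) cmN cmS.
have : (\int[gaussian 0 S]_x (x j 0)%:E = - \int[gaussian 0 S]_x (x j 0)%:E)%E.
  have [_ E] := integral_image_law mN (fun A mA => esym (symE A mA)) mj intN.
  apply: (etrans E).
  rewrite -integralN; last exact: integrable_add_def.
  by apply: eq_integral => x _; rewrite NE.
have := integrable_fin_num measurableT intj.
case: (\int[gaussian 0 S]_x (x j 0)%:E)%E => // r _ [] rN.
by congr EFin; lra.
Qed.

Lemma gaussian_coord (m : 'cV[R]_n) (j : 'I_n) :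
  (gaussian m S).-integrable setT (fun x => (x j 0)%:E) /\
  (\int[gaussian m S]_x (x j 0)%:E = (m j 0)%:E)%E.
Proof.
have mm : measurable_fun setT (fun x : 'cV[R]_n => m + x).
  exact: measurable_addmx.
have mj : measurable_fun setT (fun x : 'cV[R]_n => (x j 0)%:E).
  by apply/measurable_EFinP; exact: measurable_mx_entry.
have E A : measurable A ->
    gaussian m S A = gaussian 0 S ((fun x => m + x) @^-1` A).
  by move=> mA; rewrite gaussian_shift.
have intj := gaussian_coord_integrable j.
have intc : (gaussian 0 S).-integrable setT (cst (m j 0)%:E).
  by apply: finite_measure_integrable_cst.
have intm : (gaussian 0 S).-integrable setT
    ((fun x : 'cV[R]_n => (x j 0)%:E) \o (fun x => m + x)).
  apply: eq_integrable (integrableD measurableT intc intj) => // x _ /=.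
  by rewrite mxE EFinD.
have [-> ->] := integral_image_law mm E mj intm; split => //.
under eq_integral do rewrite /= mxE EFinD.
rewrite integralD// integral_cst// [X in (_ * X)%E](probability_setT (gaussian 0 S)).
by rewrite mule1 gaussian_coord_mean0 adde0.
Qed.

End gaussian_mean.

(** * The ridge prior in orthonormal coordinates *)

Section gram_matrix.
Context {R : realType} {W : vectType R} (f : {dot W for idfun}).

Lemma dot_sumZ q r (b : 'I_q -> W) (c : 'I_r -> W) (x : 'I_q -> R) (y : 'I_r -> R) :
  f (\sum_i x i *: b i) (\sum_j y j *: c j) =
  \sum_i \sum_j x i * (y j * f (b i) (c j)).
Proof.
rewrite linear_sumlz; apply: eq_bigr => i _.
rewrite linear_sumr; apply: eq_bigr => j _.
by rewrite linearZl_LR linearZr_LR.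
Qed.

Lemma orthonormal_tnth p (e : p.-tuple W) : orthonormal f e ->
  forall i j, f (tnth e i) (tnth e j) = (i == j)%:R.
Proof.
move=> /andP[/allP e1 eo] i j; case: eqVneq => [<-|ij].
  by apply/eqP; have := e1 _ (mem_tnth i e).
wlog ltij : i j ij / (i < j)%N.
  move=> H; have [lij|lji|/val_inj/eqP] := ltngtP i j; first exact: H.
    by apply/eqP; rewrite herm_eq0C; apply/eqP; apply: H; rewrite // eq_sym.
  by rewrite (negPf ij).
rewrite !(tnth_nth 0).
have : (j < size e)%N by rewrite size_tuple.
elim: (tval e) (i : nat) (j : nat) eo ltij => //= u s ih k l /andP[us so] kl lsz.
case: l kl lsz => // l kl lsz; case: k kl => [_|k kl] /=; last exact: ih.
by apply/eqP; move: us; rewrite andbT => /allP; apply; exact: mem_nth.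
Qed.

End gram_matrix.

Section ridge_prior_coordinates.
Context {R : realType} (rd : ridge_datum R) (W : vectType R).

(** The quadratic form of the Gram matrix at x is the squared norm of the vector
with coordinates x. *)
Lemma posdef_gram q (b : q.-tuple W) : free b -> posdef (gram rd b).
Proof.
move=> fb; have gramE (x y : 'cV[R]_q) : dotmx x (gram rd b *m y) =
    ridge_ip rd W (\sum_i x i 0 *: tnth b i) (\sum_i y i 0 *: tnth b i).
  rewrite dot_sumZ dotmx_sum; apply: eq_bigr => i _; rewrite mxE mulr_sumr.
  by apply: eq_bigr => j _; rewrite !mxE [_ * y j 0]mulrC.
split=> [|x x0].
  by apply/matrixP => i j; rewrite !mxE hermC/= expr0 mul1r.
rewrite gramE; apply: neq0_dnorm_gt0; apply: contra x0 => /eqP w0.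
apply/eqP/colP => i; rewrite mxE.
move/freeP : fb => /(_ (fun i => x i 0)); apply; rewrite -[RHS]w0.
by apply: eq_bigr => k _; rewrite (tnth_nth 0).
Qed.

(** Two sizes are kept because the reference basis of W has the length of e only
up to a proof. *)
Definition basis_change p q (e : p.-tuple W) (b : q.-tuple W) : 'M[R]_(p, q) :=
  \matrix_(i, k) coord b k (tnth e i).

Lemma dual_coord_change p q (e : p.-tuple W) (b : q.-tuple W) a :
  dual_coord e (dual_of_coord b a) = basis_change e b *m a.
Proof.
apply/colP => i; rewrite !mxE sum_lfunE; apply: eq_bigr => k _.
by rewrite scale_lfunE lfunE/= !mxE mulrC.
Qed.

Lemma gram_change p q (e : p.-tuple W) (b : q.-tuple W) : basis_of fullv b ->
  basis_change e b *m gram rd b *m (basis_change e b)^T = gram rd e.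
Proof.
move=> bb; have eE i : tnth e i = \sum_k coord b k (tnth e i) *: tnth b k.
  rewrite [LHS](coord_basis bb (memvf _)); apply: eq_bigr => k _.
  by rewrite [tnth b k](tnth_nth 0).
apply/matrixP => i j; rewrite -mulmxA !mxE [in RHS](eE i) [in RHS](eE j) dot_sumZ.
apply: eq_bigr => k _; rewrite !mxE mulr_sumr; apply: eq_bigr => l _.
by rewrite !mxE [_ * coord b l _]mulrC.
Qed.

Lemma gram_orthonormal p (e : p.-tuple W) :
  orthonormal (ridge_ip rd W) e -> gram rd e = 1%:M.
Proof.
by move=> oe; apply/matrixP => i j; rewrite !mxE (orthonormal_tnth oe).
Qed.

Lemma measurable_dual_coord p (e : p.-tuple W) :
  measurable_fun setT (dual_coord e : dual W -> 'cV[R]_p).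
Proof.
apply: measurable_mxP => i j.
rewrite (_ : (fun beta => _) = fun beta : dual W => beta (tnth e i) : R).
  exact: measurable_dual_eval.
by apply/funext => beta; rewrite mxE.
Qed.

(** The prior is defined with the reference basis of W; a change of basis turns
its Gram matrix into that of e, which is the identity. *)
Lemma cameron_martin_ridge_gaussian p (e : p.-tuple W) :
  orthonormal (ridge_ip rd W) e ->
  cameron_martin (image_law (ridge_gaussian rd W) (measurable_dual_coord e))
    (ridge_tau2 rd)%:M.
Proof.
move=> oe; set b := vbasis {:W}.
have bb : basis_of fullv b by exact: vbasisP.
have pG : posdef (ridge_tau2 rd *: gram rd b).
  by apply: posdefZ; [exact: ridge_tau2_gt0|exact/posdef_gram/(basis_free bb)].
have mphi : measurable_fun setT (dual_coord e \o dual_of_coord b).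
  exact: (measurableT_comp (measurable_dual_coord e) (measurable_dual_of_coord b)).
have covE : basis_change e b *m (ridge_tau2 rd *: gram rd b) *m
    (basis_change e b)^T = (ridge_tau2 rd)%:M.
  by rewrite -scalemxAr -scalemxAl (gram_change e bb) (gram_orthonormal oe) scalemx1.
rewrite -covE; apply: eq_cameron_martin (cameron_martin_linear mphi
  (dual_coord_change e b) (cameron_martin_gaussian pG)) => A mA.
by [].
Qed.

End ridge_prior_coordinates.

(** * Almost sure uniqueness of kernels *)

Section orthants.
Context {R : realType} {d} {T : measurableType d} {I : finType} (g : I -> T -> R).

(** The value None leaves a coordinate unconstrained: the family then contains the
whole space, and single half-spaces, besides being closed under intersection. *)
Definition orthant (q : {ffun I -> option rat}) : set T :=
  [set t | forall i, if q i is Some r then g i t < ratr r else true].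

Hypothesis mg : forall i, measurable_fun setT (g i).
Hypothesis g_initial : forall d' (X : measurableType d') (h : X -> T),
  (forall i, measurable_fun setT (fun x => g i (h x))) -> measurable_fun setT h.

Lemma measurable_orthant q : measurable (orthant q).
Proof.
rewrite (_ : orthant q = \bigcap_(i in setT)
    (if q i is Some r then g i @^-1` `]-oo, ratr r[%classic else setT)).
  apply: fin_bigcap_measurable => [|i _]; first exact: finite_finset.
  case: (q i) => // r; rewrite -[X in measurable X]setTI.
  by apply: mg => //; exact: measurable_itv.
apply/seteqP; split => t /= tq i; [move=> _|]; have := tq i.
  by case: (q i) => //= r; rewrite in_itv.
by move=> /(_ Logic.I); case: (q i) => // r; rewrite in_itv.
Qed.

(** The hypothesis [g_initial] says that the sigma-algebra of T is the one
generated by the maps g i. Each g i is measurable for the sigma-algebra generated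
by the orthants, because a half-line is a countable union of rational ones; so the
two sigma-algebras coincide and the orthants form a generating pi-system. *)
Lemma orthant_measure_unique (mu nu : {measure set T -> \bar R}) :
  (mu setT < +oo)%E -> (forall q, mu (orthant q) = nu (orthant q)) ->
  forall A, measurable A -> mu A = nu A.
Proof.
move=> muoo E A mA; pose G := range orthant.
have GT : G setT.
  exists [ffun=> None] => //; apply/seteqP; split => // t _ i.
  by rewrite ffunE.
apply: (@measure_unique _ R _ G (fun=> setT)) => //.
- apply/seteqP; split; last first.
    apply: smallest_sub; first exact: sigma_algebra_measurable.
    by move=> _ [q _ <-]; exact: measurable_orthant.
  (* T with the sigma-algebra generated by the orthants. *)
  pose T' : measurableType _ := g_sigma_algebraType G.
  have mgi i : measurable_fun setT (g i : T' -> R).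
    apply: (measurability _ (RGenInftyO.measurableE R)) => //.
    move=> _ [_ [x ->] <-]; rewrite setTI.
    rewrite (_ : _ @^-1` _ = \bigcup_(r in [set r : rat | ratr r < x])
      orthant [ffun j => if j == i then Some r else None]).
      rewrite bigcup_mkcond; apply: bigcupT_measurable_rat => r.
      by case: ifP => // _; apply: sub_sigma_algebra; eexists.
    apply/seteqP; split => t /=; rewrite in_itv/=.
      move=> /rat_in_itvoo[r /itvP rE]; exists r; rewrite /= ?rE// => j.
      by rewrite ffunE; case: eqP => // ->; rewrite rE.
    move=> [r /= rx /(_ i)]; rewrite ffunE eqxx => /lt_trans; exact.
  have mid : measurable_fun setT (id : T' -> T) by exact: g_initial.
  by move=> B mB; have := mid measurableT B mB; rewrite setTI.
- move=> _ _ [q _ <-] [r _ <-]; exists [ffun i => match q i, r i with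
    | Some a, Some b => Some (Order.min a b)
    | Some a, None => Some a | None, b => b end] => //.
  apply/seteqP; split => [t tqr|t [tq tr] i].
    split=> i; have := tqr i; rewrite ffunE.
      case: (q i) (r i) => [a|] [b|]//.
      by move=> /lt_le_trans; apply; rewrite ler_rat ge_min lexx.
    case: (q i) (r i) => [a|] [b|]//.
    by move=> /lt_le_trans; apply; rewrite ler_rat ge_min lexx orbT.
  rewrite ffunE; have := tq i; have := tr i; case: (q i) (r i) => [a|] [b|]// tb ta.
  by rewrite minEle; case: ifP.
- by rewrite bigcup_const.
- by move=> _ [q _ <-].
Qed.

End orthants.

Section kernel_ae_unique.
Context {R : realType} {d1 d2} {Y : measurableType d1} {T : measurableType d2}.
Context {J : countType} (O : J -> set T).
Hypothesis mO : forall j, measurable (O j).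
Hypothesis O_determining : forall mu nu : {measure set T -> \bar R},
  (mu setT < +oo)%E -> (forall j, mu (O j) = nu (O j)) ->
  forall A, measurable A -> mu A = nu A.

(** Integrals over all C determine a function of y almost everywhere, and
countably many null sets suffice to decide equality of the measures k y and k' y. *)
Lemma kernel_ae_unique (m : {measure set Y -> \bar R}) (k k' : R.-pker Y ~> T) :
  (m setT < +oo)%E ->
  (forall S C, measurable S -> measurable C ->
    (\int[m]_(y in C) k y S = \int[m]_(y in C) k' y S)%E) ->
  {ae m, forall y, forall S, measurable S -> k y S = k' y S}.
Proof.
move=> moo kk'.
have ik (l : R.-pker Y ~> T) S : measurable S -> m.-integrable setT (l ^~ S).
  move=> mS; apply/integrableP; split; first exact: measurable_kernel.
  apply: (@le_lt_trans _ _ (\int[m]_y 1)%E); last first.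
    by rewrite integral_cst// mul1e.
  apply: ge0_le_integral => //.
    by apply: measurableT_comp => //; exact: measurable_kernel.
  move=> y _; rewrite gee0_abs//.
  have <- : l y setT = 1%E by exact: prob_kernel.
  by apply: le_measure; rewrite ?inE.
have aeO : {ae m, forall y, forall n : nat,
    if unpickle n is Some j then k y (O j) = k' y (O j) else True}.
  apply: ae_foralln => n; case: (unpickle n) => [j|]; last exact: aeW.
  have : ae_eq m setT (k ^~ (O j)) (k' ^~ (O j)).
    apply: integral_ae_eq => //; [exact: ik|exact: measurable_kernel|].
    by move=> C _ mC; exact: kk'.
  by apply: filterS => y; apply.
apply: filterS aeO => y yO S mS; apply: O_determining => // [|j].
  by rewrite prob_kernel ltry.
by have := yO (pickle j); rewrite pickleK.
Qed.

End kernel_ae_unique.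

(** * Parameter space and kernels driven by a random source *)

Section random_map.
Context {d1 d2 d3 : measure_display} {X : measurableType d1} {Y : measurableType d2}.
Context {Z : measurableType d3} {R : realType} (P : probability X R).
Context (g : Y * X -> Z) (mg : measurable_fun setT g).

(** The law of g (y, x) for x drawn from P depends measurably on y because the
measures of the sections of a measurable set do. *)
Definition random_map (y : Y) : {measure set Z -> \bar R} :=
  image_law P (measurableT_comp mg (pair1_measurable y)).

Let measurable_random_map U : measurable U ->
  measurable_fun setT (random_map ^~ U).
Proof.
move=> mU; have mgU : measurable (g @^-1` U).
  by rewrite -[X in measurable X]setTI; exact: mg.
rewrite (_ : random_map ^~ U = P \o xsection (g @^-1` U)).
  exact: (measurable_fun_xsection P mgU).
by apply/funext => y; rewrite [RHS]/= xsectionE.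
Qed.

HB.instance Definition _ :=
  isKernel.Build _ _ _ _ R random_map measurable_random_map.

Let random_map_setT y : random_map y setT = 1%E.
Proof. exact: probability_setT. Qed.

HB.instance Definition _ :=
  Kernel_isProbability.Build _ _ _ _ R random_map random_map_setT.

End random_map.

Section product_with_dirac.
Context {R : realType} {d1 d2} {T1 : measurableType d1} {T2 : measurableType d2}.
Context (mu : probability T1 R) (s : T2).

Lemma product_diracE (A : set (T1 * T2)) : measurable A ->
  (mu \x \d_s)%E A = mu ((fun x => (x, s)) @^-1` A).
Proof.
move=> mA; have mA' : measurable ((fun x => (x, s)) @^-1` A).
  by rewrite -[X in measurable X]setTI; exact: (pair2_measurable s).
transitivity (\int[mu]_x (\1_((fun x => (x, s)) @^-1` A) x)%:E)%E; last first.
  by rewrite integral_indic// setIT.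
apply: eq_integral => x _ /=.
rewrite diracE indicE; congr ((nat_of_bool _)%:R%:E).
by apply/idP/idP; rewrite !inE /xsection /= inE.
Qed.

Lemma ge0_integral_product_dirac (f : T1 * T2 -> \bar R) :
  measurable_fun setT f -> (forall z, 0 <= f z)%E ->
  (\int[mu \x \d_s]_z f z = \int[mu]_x f (x, s))%E.
Proof.
move=> mf f0.
rewrite -(ge0_integral_image_law mu (pair2_measurable s) mf f0).
by apply: eq_measure_integral => A mA _; exact: product_diracE.
Qed.

End product_with_dirac.

Section parameter_space_coordinates.
Context {R : realType} {W : vectType R} {p : nat} (e : p.-tuple W).

Definition parameter_coordinate (i : option 'I_p) (theta : parameter_space W) : R :=
  if i is Some j then theta.1 (tnth e j) else sval theta.2.

Lemma measurable_parameter_coordinate i :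
  measurable_fun setT (parameter_coordinate i).
Proof.
case: i => [j|] /=.
  exact: (measurableT_comp (measurable_dual_eval _) measurable_fst).
exact: (measurableT_comp (@measurable_posreal_val R) measurable_snd).
Qed.

Lemma measurable_posrealP d (X : measurableType d) (h : X -> posreal R) :
  measurable_fun setT (fun x => sval (h x)) -> measurable_fun setT h.
Proof.
move=> mh; apply: (measurability (family_cylinders
  (fun (_ : unit) (s : posreal R) => sval s))) => //.
move=> _ [_ [_ _ [B mB <-]] <-]; rewrite setTI.
by have := mh measurableT B mB; rewrite setTI.
Qed.

Lemma measurable_parameter_spaceP (be : basis_of fullv e) d
    (X : measurableType d) (h : X -> parameter_space W) :
  (forall i, measurable_fun setT (fun x => parameter_coordinate i (h x))) ->
  measurable_fun setT h.
Proof.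
move=> mh; rewrite (_ : h = fun x => ((h x).1, (h x).2)); last first.
  by apply/funext => x; case: (h x).
apply: measurable_fun_pair; last exact: measurable_posrealP (mh None).
apply: measurable_dualP => w.
rewrite (_ : (fun x => _) =
    fun x => \sum_(j < p) coord e j w * (h x).1 (tnth e j)); last first.
  apply/funext => x; rewrite [in LHS](coord_basis be (memvf w)) linear_sum.
  by apply: eq_bigr => j _; rewrite linearZ/= (tnth_nth 0).
by apply: measurable_sum => j; apply: measurable_funM => //; exact: (mh (Some j)).
Qed.

End parameter_space_coordinates.

(** * The posterior of the linear model *)

Section linear_model_coordinates.
Context {R : realType} (d : design R) (rd : ridge_datum R) (sigma02 : posreal R).
Context {n p : nat} (e : p.-tuple (covariate_space d)) (enu : 'I_n -> units d).
Hypothesis he : basis_of fullv e.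
Hypothesis he1 : orthonormal (ridge_ip rd (covariate_space d)) e.
Hypothesis henu : bijective enu.

Local Notation s2 := (sval sigma02).
Local Notation tau2 := (ridge_tau2 rd).
Local Notation X := (design_matrix e enu).
Local Notation prior := (ridge_prior rd (covariate_space d) sigma02).
Local Notation Theta := (parameter_space (covariate_space d)).
Local Notation K := (X^T *m X + (s2 / tau2)%:M).
Local Notation M := (invmx K *m X^T).
Local Notation Sy := (tau2 *: (X *m X^T) + s2%:M).
Local Notation Sp := (s2 *: invmx K).
Local Notation P := (linear_model d : R.-pker Theta ~> {ffun units d -> R}).

Let s2_gt0 : 0 < s2 := svalP sigma02.

Let rho : probability 'cV[R]_p R :=
  image_law (ridge_gaussian rd (covariate_space d)) (measurable_dual_coord e).

Let nu : probability 'cV[R]_n R := image_law (noise s2) (measurable_ffun_col enu).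

Lemma linear_model_coord (a : 'cV[R]_p) (C : set 'cV[R]_n) : measurable C ->
  linear_model d (dual_of_coord e a, sigma02) (sample_coord enu @^-1` C) =
  nu [set x | C (X *m a + x)].
Proof.
move=> mC; have mC' : measurable (sample_coord enu @^-1` C).
  by rewrite -[X in measurable X]setTI; exact: (measurable_ffun_col enu).
rewrite [LHS](fprod_normal_shift s2_gt0 _ mC'); congr (noise s2 _).
have E (y : {ffun units d -> R}) :
    sample_coord enu [ffun i => dual_of_coord e a (covariate i) + y i] =
    X *m a + \col_i y (enu i).
  apply/colP => i; rewrite !mxE ffunE sum_lfunE; congr (_ + _).
  by apply: eq_bigr => j _; rewrite scale_lfunE lfunE/= !mxE mulrC.
by apply/seteqP; split => y /=; rewrite E.
Qed.

Lemma measurable_dual_of_coord_pair (s : posreal R) : measurable_fun setT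
  ((fun a => (dual_of_coord e a, s)) : 'cV[R]_p -> Theta).
Proof.
by apply: measurable_fun_pair => //; exact: measurable_dual_of_coord.
Qed.

(** The Dirac factor of the prior fixes the variance, and the slope is replaced by
its coordinates. *)
Lemma integral_prior_linear_model (S : set Theta) (C : set 'cV[R]_n) :
  measurable S -> measurable C ->
  (\int[prior]_(theta in S) P theta (sample_coord enu @^-1` C) =
   \int[rho]_(a in [set a | S (dual_of_coord e a, sigma02)])
     nu [set x | C (X *m a + x)]%R)%E.
Proof.
move=> mS mC; have mC' : measurable (sample_coord enu @^-1` C).
  by rewrite -[X in measurable X]setTI; exact: (measurable_ffun_col enu).
rewrite [LHS]integral_mkcond [RHS]integral_mkcond.
set F := _ \_ S; have mF : measurable_fun setT F.
  apply: (iffLR (measurable_restrictT _ mS)); apply: measurable_funTS.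
  exact: measurable_kernel.
have F0 theta : (0 <= F theta)%E by rewrite /F patchE; case: ifP.
rewrite [LHS](ge0_integral_product_dirac _ _ mF F0).
have mpair := measurable_dual_of_coord_pair sigma02.
transitivity (\int[rho]_a F (dual_of_coord e a, sigma02))%E.
  rewrite [RHS](ge0_integral_image_law _ _ (measurableT_comp mF mpair)).
    by apply: eq_integral => beta _ /=; rewrite dual_coordK.
  by move=> a; exact: F0.
apply: eq_integral => a _; rewrite /F !patchE.
have -> : ((dual_of_coord e a, sigma02) \in S) =
    (a \in [set a | S (dual_of_coord e a, sigma02)]).
  by apply/idP/idP; rewrite !in_setE.
case: (a \in [set a | S (dual_of_coord e a, sigma02)]); last by [].
exact: linear_model_coord.
Qed.

Lemma bayes_in_coordinates (S : set Theta) (C : set 'cV[R]_n) :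
  measurable S -> measurable C ->
  (\int[prior]_(theta in S) P theta (sample_coord enu @^-1` C) =
   \int[gaussian 0 Sy%R]_(y in C) gaussian (M *m y)%R Sp%R
     [set a | S (dual_of_coord e a, sigma02)])%E.
Proof.
move=> mS mC; rewrite integral_prior_linear_model//.
apply: gaussian_bayes => //.
- exact: ridge_tau2_gt0.
- exact: cameron_martin_ridge_gaussian.
- exact: cameron_martin_noise_col.
- rewrite -[X in measurable X]setTI.
  exact: (measurable_dual_of_coord_pair sigma02).
Qed.

Lemma prior_predictive (A : set 'cV[R]_n) : measurable A ->
  push_state prior P (sample_coord enu @^-1` A) = gaussian 0 Sy A.
Proof.
move=> mA; rewrite push_stateE bayes_in_coordinates//.
rewrite (eq_integral (cst 1%E)); last first.
  by move=> y _; exact: probability_setT.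
by rewrite integral_cst// mul1e.
Qed.

(** A posterior draw: the ridge estimator plus a Gaussian perturbation, with the
known variance attached. *)
Definition posterior_map (yz : {ffun units d -> R} * {ffun 'I_p -> R}) : Theta :=
  (dual_of_coord e (affine_map (M *m sample_coord enu yz.1) (mxsqrt Sp) yz.2),
   sigma02).

Lemma measurable_posterior_map : measurable_fun setT posterior_map.
Proof.
apply: (measurableT_comp (measurable_dual_of_coord_pair sigma02) (g := fun yz =>
  affine_map (M *m sample_coord enu yz.1) (mxsqrt Sp) yz.2)).
apply: measurable_addmx; apply: measurable_mulmx => //.
  exact: (measurableT_comp (measurable_ffun_col enu) measurable_fst).
exact: (measurableT_comp (measurable_ffun_col (@id 'I_p)) measurable_snd).
Qed.

Definition posterior : R.-pker {ffun units d -> R} ~> Theta :=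
  random_map std_normal measurable_posterior_map.

Lemma posteriorE y (S : set Theta) : posterior y S =
  gaussian (M *m sample_coord enu y) Sp [set a | S (dual_of_coord e a, sigma02)].
Proof. by []. Qed.

(** A measurable set of samples is the preimage of a set of coordinate vectors, so
[bayes_in_coordinates] applies; its right-hand side is then carried back to the
sample space through the predictive law. *)
Lemma bayesian_inversion_posterior : bayesian_inversion prior P posterior.
Proof.
move=> S C mS mC; have [enu' enuK enu'K] := henu.
pose inv (x : 'cV[R]_n) : {ffun units d -> R} := [ffun u => x (enu' u) 0].
have minv : measurable_fun setT inv.
  apply: measurable_ffunP => u.
  rewrite (_ : (fun x => _) = fun x : 'cV[R]_n => x (enu' u) 0).
    exact: measurable_mx_entry.
  by apply/funext => x; rewrite ffunE.
have invK y : inv (sample_coord enu y) = y.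
  by apply/ffunP => u; rewrite ffunE mxE enu'K.
have scK x : sample_coord enu (inv x) = x.
  by apply/colP => i; rewrite mxE ffunE enuK.
have msc := measurable_ffun_col enu : measurable_fun setT (sample_coord enu).
have mC' : measurable (inv @^-1` C).
  by rewrite -[X in measurable X]setTI; exact: minv.
have CE : C = sample_coord enu @^-1` (inv @^-1` C).
  by apply/seteqP; split => y /=; rewrite invK.
rewrite [in LHS]CE bayes_in_coordinates//.
rewrite (eq_measure_integral (pushforward (push_state prior P) (sample_coord enu))).
  rewrite ge0_integral_pushforward//.
  - by rewrite -CE; apply: eq_integral => y _.
  - have -> : (fun y : 'cV[R]_n => gaussian (M *m y) Sp
      [set a | S (dual_of_coord e a, sigma02)]) = (fun y => posterior (inv y) S).
      by apply/funext => x; rewrite posteriorE scK.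
    apply: measurable_funTS.
    exact: (measurableT_comp (measurable_kernel posterior _ mS) minv).
by move=> A mA _; exact/esym/prior_predictive.
Qed.

Lemma posterior_unique (k : R.-pker {ffun units d -> R} ~> Theta) :
  bayesian_inversion prior P k ->
  {ae push_state prior P, forall y, forall S, measurable S -> k y S = posterior y S}.
Proof.
move=> invk; apply: (kernel_ae_unique
  (O := orthant (parameter_coordinate e)) (T := Theta)).
- move=> q; apply: measurable_orthant => i.
  exact: measurable_parameter_coordinate.
- move=> mu1 mu2; apply: orthant_measure_unique.
    by move=> i; exact: measurable_parameter_coordinate.
  by move=> ? Z h; exact: (measurable_parameter_spaceP he).
- rewrite push_stateE (eq_integral (cst 1%E)).
    by rewrite integral_cst// mul1e [X in (X < _)%E]probability_setT ltry.
  by move=> theta _; exact: prob_kernel.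
- by move=> S C mS mC; rewrite -invk// bayesian_inversion_posterior.
Qed.

Lemma posterior_coord y (A : set ('cV[R]_p * posreal R)) : measurable A ->
  posterior y (parameter_coord e @^-1` A) =
  (gaussian (M *m sample_coord enu y)%R Sp%R \x \d_sigma02)%E A.
Proof.
move=> mA; rewrite product_diracE// posteriorE; congr (gaussian _ _ _).
by apply/seteqP; split => a /=; rewrite /parameter_coord /= dual_of_coordK.
Qed.

Lemma posterior_mean y (j : 'I_p) :
  (posterior y).-integrable setT (fun theta => (dual_coord e theta.1 j 0)%:E) /\
  (\int[posterior y]_theta (dual_coord e theta.1 j 0)%:E =
    (ridge_estimator X (s2 / tau2) (sample_coord enu y) j 0)%:E)%E.
Proof.
have [intj <-] := gaussian_coord (posdef_posterior X (ridge_tau2_gt0 rd) s2_gt0)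
  (M *m sample_coord enu y) j.
have mj : measurable_fun setT (fun theta : Theta => (dual_coord e theta.1 j 0)%:E).
  apply/measurable_EFinP/measurable_mx_coef.
  exact: (measurableT_comp (measurable_dual_coord e) measurable_fst).
have jE (a : 'cV[R]_p) : (dual_coord e (dual_of_coord e a) j 0)%:E = (a j 0)%:E.
  by rewrite dual_of_coordK.
have [-> ->] := integral_image_law (measurable_dual_of_coord_pair sigma02)
  (Q := posterior y) (P := gaussian (M *m sample_coord enu y) Sp)
  (fun S _ => posteriorE y S) mj
  (eq_integrable measurableT _ _ (fun a _ => esym (jE a)) intj).
by split => //; apply: eq_integral => a _; rewrite jE.
Qed.

End linear_model_coordinates.

Theorem proposition9p2 (R : realType) (d : design R) (rd : ridge_datum R)
    (sigma02 : posreal R) (n p : nat) (e : p.-tuple (covariate_space d))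
    (enu : 'I_n -> units d)
    (he : basis_of fullv e)
    (he1 : orthonormal (ridge_ip rd (covariate_space d)) e)
    (henu : bijective enu) :
  let tau2 := ridge_tau2 rd in
  let s2 := sval sigma02 in
  let lam := s2 / tau2 in
  let X := design_matrix e enu in
  let P := linear_model d : R.-pker _ ~> _ in
  let prior := ridge_prior rd (covariate_space d) sigma02 in
  let m := push_state prior P in
  [/\
    (* prior predictive state *)
    forall A : set 'cV[R]_n, measurable A ->
      m (sample_coord enu @^-1` A) =
      gaussian 0 (tau2 *: (X *m X^T) + s2%:M) A,
    (* posterior and its mean *)
    exists Pinv : R.-pker {ffun units d -> R} ~>
                          parameter_space (covariate_space d),
      [/\ bayesian_inversion prior P Pinv,
        forall Pinv' : R.-pker {ffun units d -> R} ~>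
                               parameter_space (covariate_space d),
          bayesian_inversion prior P Pinv' ->
          {ae m, forall y, forall S, measurable S -> Pinv' y S = Pinv y S},
        forall y (A : set ('cV[R]_p * posreal R)), measurable A ->
          Pinv y (parameter_coord e @^-1` A) =
          (gaussian
             (invmx (X^T *m X + lam%:M) *m X^T *m sample_coord enu y)
             (s2 *: invmx (X^T *m X + lam%:M)) \x \d_sigma02)%E A
        & forall y (j : 'I_p),
          (Pinv y).-integrable setT
            (fun theta => (dual_coord e theta.1 j 0)%:E) /\
          (\int[Pinv y]_theta (dual_coord e theta.1 j 0)%:E =
            (ridge_estimator X lam (sample_coord enu y) j 0)%:E)%E]
    & lam = s2 / tau2].
Proof.
move=> tau2 s2 lam X P prior m; split => [A mA||//].
  exact: prior_predictive.
exists (posterior rd sigma02 e enu); split.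
- exact: bayesian_inversion_posterior.
- by move=> k; exact: posterior_unique.
- by move=> y A mA; exact: posterior_coord.
- by move=> y j; exact: posterior_mean.
Qed.
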